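(* Let $(M,h)$ be a closed Riemannian spin manifold, let $(N,g)$ be a Riemannian manifold of constant curvature $K$, let $X$ be a Killing vector field on $N$, let $\kappa\in\mathbb{R}$, and let $(\phi,\psi)$ be a smooth $\kappa$-Dirac-harmonic map from $M$ to $N$. Then the current defined by $$J_\alpha:=2\langle d\phi(e_\alpha),X(\phi)\rangle-\langle\nabla_\psi X(\phi),e_\alpha\cdot\psi\rangle$$ is conserved, that is, $\nabla_{e_\alpha}J_\alpha=0$ (the divergence of $J$ on $M$ vanishes).
   Context: $\Sigma M$ is the spinor bundle of $(M,h)$ with hermitian scalar product $\langle\cdot,\cdot\rangle_{\Sigma M}$ (conjugate-linear in the first slot, linear in the second) and metric spin connection. Clifford multiplication is skew-symmetric, $\langle\psi,Y\cdot\eta\rangle=-\langle Y\cdot\psi,\eta\rangle$, and satisfies $Y\cdot Z\cdot\psi+Z\cdot Y\cdot\psi=-2h(Y,Z)\psi$. $(e_\alpha)$ is a local orthonormal frame of $TM$ and repeated indices are summed. For a map $\phi\colon M\to N$, a vector spinor is a section $\psi$ of $\Sigma M\otimes\phi^\ast TN$, locally $\psi=\psi^i\otimes\partial_{y^i}$ with $\partial_{y^i}$ a local basis of $TN$ along $\phi$. With $\tilde\nabla$ the induced connection on $\Sigma M\otimes\phi^\ast TN$, the twisted Dirac operator is $\not D=e_\alpha\cdot\tilde\nabla_{e_\alpha}$. Put $R^N(Y,Z)=[\nabla_Y,\nabla_Z]-\nabla_{[Y,Z]}$ and $R_{ijkl}=\langle R^N(\partial_{y^i},\partial_{y^j})\partial_{y^l},\partial_{y^k}\rangle$,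 so that constant curvature $K$ means $R_{ijkl}=K(g_{ik}g_{jl}-g_{il}g_{jk})$. $\kappa$-Dirac-harmonic maps are the critical points of $$E_\kappa(\phi,\psi)=\int_M\big(|d\phi|^2+\langle\psi,\not D\psi\rangle+\kappa R_{ijkl}\langle\psi^i,\psi^k\rangle_{\Sigma M}\langle\psi^j,\psi^l\rangle_{\Sigma M}\big)dM,$$ i.e. the solutions of $$\tau(\phi)=\tfrac12\langle\psi^i,e_\alpha\cdot\psi^j\rangle R^N(\partial_{y^i},\partial_{y^j})d\phi(e_\alpha)+\tfrac{\kappa}{2}(\nabla^\sharp R)_{ijkl}\langle\psi^i,\psi^k\rangle\langle\psi^j,\psi^l\rangle,$$ $$(\not D\psi)^i=-2\kappa\, R^{i}{}_{jkl}\langle\psi^j,\psi^l\rangle\psi^k,$$ where $\tau(\phi)$ is the tension field and $(\nabla^\sharp R)_{ijkl}$ is the vector dual to $V\mapsto(\nabla_VR)_{ijkl}$. A vector field $X$ on $N$ is Killing if $\mathcal{L}_Xg=0$, i.e. $\nabla_{\partial_{y^i}}X_j+\nabla_{\partial_{y^j}}X_i=0$. The notation in $J_\alpha$ means $$\langle\nabla_\psi X(\phi),e_\alpha\cdot\psi\rangle:=\langle\psi^i,e_\alpha\cdot\psi^j\rangle_{\Sigma M}\,\nabla_{\partial_{y^i}}X_j,$$ with $X_j=g_{jk}X^k$, evaluated along $\phi$. $J$ is viewed as a one-form (vector field) on $M$ with $J_\alpha=J(e_\alpha)$. *)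

(* Defs.v *)
From HB Require Import structures.
From mathcomp Require Import all_boot all_order all_algebra.
From mathcomp Require Import all_classical all_reals all_analysis.
From mathcomp Require Export complex.
Set Implicit Arguments.
Unset Strict Implicit.
Unset Printing Implicit Defensive.
Import Order.TTheory GRing.Theory Num.Theory.
Import numFieldNormedType.Exports.
Local Open Scope classical_set_scope.
Local Open Scope ring_scope.
Local Open Scope complex_scope.

(* Fields on a manifold are functions of the point p.  A tensor field is given
   by its components in every chart, subject to the usual transformation law;
   what such a family does outside the domain of the chart is irrelevant. *)

Record charted (R : realType) (m : nat) := Charted {
  carrier :> topologicalType;
  chart : Type;
  dom : chart -> set carrier;
  coord : chart -> carrier -> 'rV[R]_m;
  point : chart -> 'rV[R]_m -> carrier
}.
Arguments dom {R m M} a : rename.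
Arguments coord {R m M} a p : rename.
Arguments point {R m M} a x : rename.

Section Smooth.
Context {R : realType} {m : nat} {M : charted R m}.
Implicit Types (a b : chart M) (U : set M) (f : M -> R) (p : M).

Definition pd a (i : 'I_m) f p : R :=
  'D_(delta_mx 0 i) (f \o point a) (coord a p).

(* Class C^k on U in the chart a, for U an open subset of dom a. *)
Fixpoint Ck a U (k : nat) f : Prop :=
  (forall p, U p -> {for p, continuous f}) /\
  (if k is k'.+1 then
     forall i, (forall p, U p ->
                  derivable (f \o point a) (coord a p) (delta_mx 0 i)) /\
               Ck a U k' (pd a i f)
   else True).

Definition smooth_on U f := forall a k, Ck a (U `&` dom a) k f.

Definition jac a b p : 'M[R]_m :=
  \matrix_(i, j) pd a i (fun q => coord b q 0 j) p.

Definition smoothC_on U (f : M -> R[i]) :=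
  smooth_on U (fun p => complex.Re (f p)) /\
  smooth_on U (fun p => complex.Im (f p)).

Definition pdC a (i : 'I_m) (f : M -> R[i]) p : R[i] :=
  pd a i (fun q => complex.Re (f q)) p +i* pd a i (fun q => complex.Im (f q)) p.

End Smooth.

Record manifold (R : realType) (m : nat) := Manifold {
  charted_of :> charted R m;
  mfd_hausdorff : hausdorff_space charted_of;
  mfd_second_countable : @second_countable charted_of;
  dom_cover : forall p : charted_of, exists a, dom a p;
  dom_open : forall a : chart charted_of, open (dom a);
  image_open : forall a : chart charted_of, open (coord a @` dom a);
  coordK : forall (a : chart charted_of) p, dom a p -> point a (coord a p) = p;
  coord_continuous : forall (a : chart charted_of) p, dom a p ->
    {for p, continuous (coord a)};
  point_continuous : forall (a : chart charted_of) p, dom a p ->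
    {for coord a p, continuous (point a)};
  transition_smooth : forall (b : chart charted_of) j,
    smooth_on (dom b) (fun p => coord b p 0 j)
}.

(* Closed: compact without boundary; charts are onto open subsets of R^m, so
   there is never a boundary. *)
Definition closed_manifold (R : realType) (m : nat) (M : manifold R m) :=
  compact [set: M].

Definition vector_field_on (R : realType) (m : nat) (M : manifold R m)
    (U : set M) (X : chart M -> M -> 'rV[R]_m) :=
  (forall a i, smooth_on (U `&` dom a) (fun p => X a p 0 i)) /\
  (forall a b p, U p -> dom a p -> dom b p -> X b p = X a p *m jac a b p).

Record metric (R : realType) (m : nat) (M : manifold R m) := Metric {
  gmx :> chart M -> M -> 'M[R]_m;
  metric_smooth : forall a i j, smooth_on (dom a) (fun p => gmx a p i j);
  metric_sym : forall a p, dom a p -> (gmx a p)^T = gmx a p;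
  metric_posdef : forall a p, dom a p -> forall v : 'rV[R]_m, v != 0 ->
    0 < (v *m gmx a p *m v^T) 0 0;
  metric_transform : forall a b p, dom a p -> dom b p ->
    gmx a p = jac a b p *m gmx b p *m (jac a b p)^T
}.

Section LeviCivita.
Context {R : realType} {m : nat} {M : manifold R m} (g : metric M).
Implicit Types (a : chart M) (p : M) (i j k l q r s : 'I_m).
Implicit Types (X : chart M -> M -> 'rV[R]_m).

Definition inner a p (u v : 'rV[R]_m) : R :=
  \sum_i \sum_j g a p i j * u 0 i * v 0 j.

(* Gamma^k_{ij} *)
Definition christoffel a k i j p : R :=
  2^-1 * \sum_l invmx (g a p) k l *
    (pd a i (fun x => g a x j l) p + pd a j (fun x => g a x i l) p
     - pd a l (fun x => g a x i j) p).

(* j-th component of nabla_i X *)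
Definition nabla_vec X a i j p : R :=
  pd a i (fun x => X a x 0 j) p + \sum_k christoffel a j i k p * X a p 0 k.

(* X_j = g_{jk} X^k *)
Definition lower X a j p : R := \sum_k g a p j k * X a p 0 k.

(* nabla_i X_j *)
Definition nabla_lower X a i j p : R :=
  pd a i (lower X a j) p - \sum_k christoffel a k i j p * lower X a k p.

Definition killing X :=
  forall a p, dom a p -> forall i j,
    nabla_lower X a i j p + nabla_lower X a j i p = 0.

(* k-th component of R(d_i, d_j) d_l, where
   R(Y, Z) = [nabla_Y, nabla_Z] - nabla_[Y, Z] *)
Definition riemann a i j l k p : R :=
  pd a i (christoffel a k j l) p - pd a j (christoffel a k i l) p
  + \sum_q (christoffel a k i q p * christoffel a q j l p
            - christoffel a k j q p * christoffel a q i l p).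

(* R_{ijkl} = <R(d_i, d_j) d_l, d_k> *)
Definition curv a i j k l p : R := \sum_q g a p q k * riemann a i j l q p.

(* R^i_{jkl} *)
Definition curv_up a i j k l p : R :=
  \sum_q invmx (g a p) i q * curv a q j k l p.

(* (nabla_r R)_{ijkl} *)
Definition nabla_curv a r i j k l p : R :=
  pd a r (curv a i j k l) p
  - \sum_q (christoffel a q r i p * curv a q j k l p
            + christoffel a q r j p * curv a i q k l p
            + christoffel a q r k p * curv a i j q l p
            + christoffel a q r l p * curv a i j k q p).

(* s-th component of the vector dual to V |-> (nabla_V R)_{ijkl} *)
Definition nabla_curv_sharp a s i j k l p : R :=
  \sum_r invmx (g a p) s r * nabla_curv a r i j k l p.

Definition constant_curvature (K : R) :=
  forall a p, dom a p -> forall i j k l,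
    curv a i j k l p
    = K * (g a p i k * g a p j l - g a p i l * g a p j k).

End LeviCivita.

Definition spdim (m : nat) : nat := (2 ^ m./2)%N.

(* A complex Clifford module of dimension 2^[m/2] is automatically irreducible:
   gam is the action of an orthonormal basis of R^m on complex spinors. *)
Record clifford_rep (R : realType) (m : nat) := CliffordRep {
  gam :> 'I_m -> 'M[R[i]]_(spdim m);
  clifford : forall i j,
    gam i *m gam j + gam j *m gam i = (- 2 * (i == j)%:R)%:M;
  gam_skew : forall i, (map_mx (@conjc R) (gam i))^T = - gam i
}.

Definition clifford_mul (R : realType) (m : nat) (gam : clifford_rep R m)
    (v : 'rV[R]_m) : 'M[R[i]]_(spdim m) :=
  \sum_i (v 0 i)%:C *: gam i.

(* Spin(m): products of an even number of unit vectors.  The even complex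
   Clifford algebra acts faithfully on spinors, so that Spin(m) is identified
   with its image in the matrices. *)
Definition spin_group (R : realType) (m : nat) (gam : clifford_rep R m)
    (S : 'M[R[i]]_(spdim m)) : Prop :=
  exists vs : seq 'rV[R]_m,
    [/\ ~~ odd (size vs),
        (forall v, v \in vs -> \sum_i v 0 i ^+ 2 = 1)
      & S = \big[mulmx/1%:M]_(v <- vs) clifford_mul gam v].

(* A spin structure as a cocycle: a cover of M by open sets with orthonormal
   frames, and a lift to Spin(m) of the transition functions between these
   frames.  Where the frames s and t both live,
     e^t_j = sum_i h(e^s_i, e^t_j) e^s_i,
   and lift s t changes spinor components from t to s; lift_covers says that
   lift s t is mapped to the change of frame under Spin(m) -> SO(m). *)
Record spin_structure (R : realType) (m : nat) (M : manifold R m)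
    (h : metric M) (gam : clifford_rep R m) := SpinStructure {
  sp_idx : Type;
  sp_dom : sp_idx -> set M;
  frame : sp_idx -> 'I_m -> chart M -> M -> 'rV[R]_m;
  lift : sp_idx -> sp_idx -> M -> 'M[R[i]]_(spdim m);
  sp_open : forall t, open (sp_dom t);
  sp_cover : forall p : M, exists t, sp_dom t p;
  frame_field : forall t i, vector_field_on (sp_dom t) (frame t i);
  frame_orthonormal : forall t a p, sp_dom t p -> dom a p -> forall i j,
    inner h a p (frame t i a p) (frame t j a p) = (i == j)%:R;
  lift_smooth : forall s t i j,
    smoothC_on (sp_dom s `&` sp_dom t) (fun p => lift s t p i j);
  lift_spin : forall s t p, sp_dom s p -> sp_dom t p ->
    spin_group gam (lift s t p);
  lift_covers : forall s t a p, sp_dom s p -> sp_dom t p -> dom a p ->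
    forall j, lift s t p *m gam j
      = (\sum_i (inner h a p (frame s i a p) (frame t j a p))%:C *: gam i)
        *m lift s t p;
  lift_cocycle : forall r s t p, sp_dom r p -> sp_dom s p -> sp_dom t p ->
    lift r s p *m lift s t p = lift r t p
}.

(* Hermitian product, conjugate-linear in the first slot. *)
Definition herm (R : realType) (d : nat) (u v : 'cV[R[i]]_d) : R[i] :=
  \sum_i conjc (u i 0) * v i 0.

Definition smooth_map (R : realType) (m n : nat) (M : manifold R m)
    (N : manifold R n) (phi : M -> N) :=
  continuous phi /\
  forall (b : chart N) j,
    smooth_on (phi @^-1` dom b) (fun p => coord b (phi p) 0 j).

Section DiracHarmonic.
Context {R : realType} {m n : nat} {M : manifold R m} {h : metric M}.
Context {gam : clifford_rep R m} (sp : spin_structure h gam).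
Context {N : manifold R n} (g : metric N) (phi : M -> N).
(* psi t b p i is psi^i at p: its spinor components in the trivialization t,
   for the basis d/dy^i of the chart b of N. *)
Variable psi : sp_idx sp -> chart N -> M -> 'I_n -> 'cV[R[i]]_(spdim m).
Implicit Types (t : sp_idx sp) (a : chart M) (b : chart N) (p : M).
Implicit Types (al be ga mu nu la : 'I_m) (i j k l : 'I_n).

Definition vector_spinor :=
  (forall t b i s, smoothC_on (sp_dom t `&` phi @^-1` dom b)
                     (fun p => psi t b p i s 0)) /\
  (forall s t b c p, sp_dom s p -> sp_dom t p ->
     dom b (phi p) -> dom c (phi p) -> forall j,
     psi s c p j
     = \sum_i (jac b c (phi p) i j)%:C *: (lift s t p *m psi t b p i)).

(* h(nabla_mu e_be, e_ga) *)
Definition spin_form t a mu be ga p : R :=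
  inner h a p (\row_nu nabla_vec h (frame t be) a mu nu p) (frame t ga a p).

(* i-th component of d phi(d_mu) *)
Definition dphi a b mu i p : R := pd a mu (fun q => coord b (phi q) 0 i) p.

(* i-th component of d phi(e_al) *)
Definition dphi_frame t a b al i p : R :=
  \sum_mu frame t al a p 0 mu * dphi a b mu i p.

(* i-th component of (nabla d phi)(d_mu, d_nu) *)
Definition hess a b mu nu i p : R :=
  pd a mu (dphi a b nu i) p
  - \sum_la christoffel h a la mu nu p * dphi a b la i p
  + \sum_j \sum_k christoffel g b i j k (phi p) * dphi a b mu j p
                  * dphi a b nu k p.

(* tau(phi) = (nabla d phi)(e_al, e_al) *)
Definition tension t a b i p : R :=
  \sum_al \sum_mu \sum_nu
    frame t al a p 0 mu * frame t al a p 0 nu * hess a b mu nu i p.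

(* Connection on Sigma M (x) phi^* TN, along d_mu; the spin connection is
   d + 1/4 sum_{be,ga} h(nabla e_be, e_ga) e_be . e_ga . *)
Definition nabla_psi t a b mu i p : 'cV[R[i]]_(spdim m) :=
  \col_s pdC a mu (fun q => psi t b q i s 0) p
  + 4^-1 *: \sum_be \sum_ga
      (spin_form t a mu be ga p)%:C *: (gam be *m gam ga *m psi t b p i)
  + \sum_j \sum_k (christoffel g b i j k (phi p) * dphi a b mu j p)%:C
                  *: psi t b p k.

Definition dirac t a b i p : 'cV[R[i]]_(spdim m) :=
  \sum_al gam al *m
    (\sum_mu (frame t al a p 0 mu)%:C *: nabla_psi t a b mu i p).

Definition kappa_dirac_harmonic (kappa : R) :=
  forall t a b p, sp_dom t p -> dom a p -> dom b (phi p) -> forall r : 'I_n,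
  (tension t a b r p)%:C
  = 2^-1 * (\sum_al \sum_i \sum_j \sum_l
       herm (psi t b p i) (gam al *m psi t b p j)
       * (riemann g b i j l r (phi p) * dphi_frame t a b al l p)%:C)
    + (kappa / 2)%:C * (\sum_i \sum_j \sum_k \sum_l
       (nabla_curv_sharp g b r i j k l (phi p))%:C
       * herm (psi t b p i) (psi t b p k) * herm (psi t b p j) (psi t b p l))
  /\
  dirac t a b r p
  = (- 2 * kappa)%:C *: \sum_j \sum_k \sum_l
      ((curv_up g b r j k l (phi p))%:C
       * herm (psi t b p j) (psi t b p l)) *: psi t b p k.

(* J_al = J(e_al), as a function of the point.  It is a priori complex. *)
Definition current (X : chart N -> N -> 'rV[R]_n) t a b al p : R[i] :=
  (2 * inner g b (phi p) (\row_i dphi_frame t a b al i p) (X b (phi p)))%:C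
  - \sum_i \sum_j herm (psi t b p i) (gam al *m psi t b p j)
                  * (nabla_lower g X b i j (phi p))%:C.

(* Divergence of the one-form J with J(e_al) = J al:
   (nabla_{e_al} J)(e_al) = e_al (J(e_al)) - J(nabla_{e_al} e_al). *)
Definition divergence t a (J : 'I_m -> M -> R[i]) p : R[i] :=
  \sum_al \sum_mu (frame t al a p 0 mu)%:C *
    (pdC a mu (J al) p - \sum_be (spin_form t a mu al be p)%:C * J be p).

Definition conserved (J : sp_idx sp -> chart M -> chart N -> 'I_m -> M -> R[i])
  := forall t a b p, sp_dom t p -> dom a p -> dom b (phi p) ->
       divergence t a (J t a b) p = 0.

End DiracHarmonic.

(* Main.v *)
(** Write [e_al] for the frame, [S_ij = nabla_i X_j] and
    [T_kij = nabla_k nabla_i X_j] along [phi].  The Leibniz rule and the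
    compatibility of the spin connection with Clifford multiplication give
    [div J = 2 <tau, X> + 2 S(dphi e_al, dphi e_al)
             + (<D psi^i, psi^j> - <psi^i, D psi^j>) S_ij
             - <psi^i, e_al psi^j> T(dphi e_al)_ij].
    The second term vanishes because [S] is antisymmetric.  In constant
    curvature the right-hand side of the Dirac equation acts symmetrically on
    the components [psi^i], so that the third term vanishes too; moreover
    [nabla R = 0], and commuting derivatives turns the Killing equation into
    [T_kij = K (X_i g_kj - X_j g_ki)], by which the fourth term cancels
    [2 <tau, X>]. *)

From HB Require Import structures.
From mathcomp Require Import all_boot all_order all_algebra.
From mathcomp Require Import all_classical all_reals all_analysis.
From mathcomp Require Import ring lra.
Require Import Defs.

Set Implicit Arguments.
Unset Strict Implicit.
Unset Printing Implicit Defensive.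
Import Order.TTheory GRing.Theory Num.Theory.
Import numFieldNormedType.Exports.
Local Open Scope classical_set_scope.
Local Open Scope ring_scope.
Local Open Scope complex_scope.

(** The computation takes place at one point, in one trivialization of the spinors and one chart on
    each side. The obstacle is analytic: smoothness only says that iterated partial derivatives
    exist and are continuous. Differentiating [X] along [phi] takes a chain rule, hence total
    differentiability, and commuting the derivatives of [X_j] takes Schwarz's theorem; both are
    drawn from the mean value theorem. Each geometric identity is then split in two. Calculus
    delivers the derivatives as [is_pd] facts; an identity between finite sums, in which these
    derivatives are independent letters, does the rest. Two cancellations deserve a reason. With H
    the matrix of the products <psi^i, psi^j>, both <psi^i, D psi^j> and <D psi^i, psi^j> equal -2
    kappa K (tr(gH) H - H g H)_ij. And K (X_i g_kj - X_j g_ki) is precisely <R(d_i, d_j) d_k, X>, so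
    that the fourth term carries the same curvature expression as the tension equation, whose 1/2 is
    absorbed by the factor 2 in the current. *)

Section PartialDerivatives.
Context {R : realType}.

(** * Mean values, total differentials and Schwarz's theorem *)

Lemma is_derive_translate (V W : normedModType R) (f : V -> W) x v a df :
  is_derive (x + a) v f df -> is_derive x v (fun y => f (y + a)) df.
Proof.
case=> dfxa <-; have E : (fun h => h^-1 *: (((fun y => f (y + a)) \o shift x)
    (h *: v) - f (x + a))) = (fun h => h^-1 *: ((f \o shift (x + a)) (h *: v)
    - f (x + a))).
  by apply/funext => h /=; rewrite addrA.
by split; rewrite /derivable /derive E.
Qed.

Lemma is_derive_line (V W : normedModType R) (f : V -> W) x v s df :
  is_derive (x + s *: v) v f df ->
  is_derive s 1 (fun t : R => f (x + t *: v)) df.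
Proof.
case=> dfxa <-.
have E : (fun h => h^-1 *: (((fun t : R => f (x + t *: v)) \o shift s)
    (h *: (1 : R)) - f (x + s *: v))) =
    (fun h => h^-1 *: ((f \o shift (x + s *: v)) (h *: v) - f (x + s *: v))).
  apply/funext => h /=; rewrite [h *: 1]mulr1 scalerDl.
  by congr (_ *: (f _ - _)); rewrite addrCA.
by split; rewrite /derivable /derive E.
Qed.

(** Increments along a coordinate axis may be negative, so [t] has either sign and the two
    orientations of the segment are treated apart. *)
Lemma MVT_line (V : normedModType R) (f : V -> R) (x v : V) (t : R) :
  (forall s : R, `|s| <= `|t| -> derivable f (x + s *: v) v) ->
  exists2 c : R, `|c| <= `|t| & f (x + t *: v) - f x = t * 'D_v f (x + c *: v).
Proof.
move=> df; pose g s := f (x + s *: v).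
have dg (s : R) : `|s| <= `|t| -> is_derive s 1 g ('D_v f (x + s *: v)).
  by move=> /df /derivableP; exact: is_derive_line.
have cg a b : (forall s, s \in `[a, b] -> `|s| <= `|t|) ->
    {within `[a, b], continuous g}.
  by move=> ab; apply: derivable_within_continuous => s /ab /dg [].
have g0 : g 0 = f x by rewrite /g scale0r addr0.
rewrite -/(g t) -g0; case: (leP 0 t) => t0.
- have ht s : s \in `[0, t] -> `|s| <= `|t|.
    by rewrite in_itv/= => /andP[s0 st]; rewrite !ger0_norm.
  have dg' s : s \in `]0, t[ -> is_derive s 1 g ('D_v f (x + s *: v)).
    by move=> st; apply: dg; apply: ht; exact: subset_itv_oo_cc.
  have [c ct ->] := MVT_segment t0 dg' (cg _ _ ht).
  by exists c; [exact: ht|rewrite subr0 mulrC].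
- have ht s : s \in `[t, 0] -> `|s| <= `|t|.
    by rewrite in_itv/= => /andP[st s0]; rewrite !ler0_norm ?lerN2// ltW.
  have dg' s : s \in `]t, 0[ -> is_derive s 1 g ('D_v f (x + s *: v)).
    by move=> st; apply: dg; apply: ht; exact: subset_itv_oo_cc.
  have [c ct E] := MVT_segment (ltW t0) dg' (cg _ _ ht).
  exists c; first exact: ht.
  by rewrite -opprB E sub0r mulrN opprK mulrC.
Qed.

(** The candidate for the differential of a function whose partial derivatives are [c]; the linear
    structure declared below lets [diff_unique] accept it. *)
Definition linear_form n (c : 'I_n -> R) (y : 'rV[R]_n) : R :=
  \sum_i y 0 i * c i.

Lemma linear_form_is_linear n (c : 'I_n -> R) : linear (linear_form c : _ -> R^o).
Proof.
move=> k u v; rewrite /linear_form scaler_sumr -big_split/=.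
by apply: eq_bigr => i _; rewrite !mxE mulrDl -mulrA.
Qed.

HB.instance Definition _ n (c : 'I_n -> R) :=
  GRing.isLinear.Build R 'rV[R]_n R^o _ (linear_form c) (linear_form_is_linear c).

Lemma continuous_linear_form n (c : 'I_n -> R) : continuous (linear_form c).
Proof.
apply: continuous_big => [|i _ y]; first exact: add_continuous.
apply: (@continuousM _ _ (fun z : 'rV[R]_n => z 0 i) (cst (c i))).
  exact: matrix_normedtype.coord_continuous.
exact: cst_continuous.
Qed.

Lemma rV_norm_coord n (y : 'rV[R]_n) i : `|y 0 i| <= `|y|.
Proof.
rewrite [leRHS]/Num.Def.normr/= mx_normrE.
exact: (le_bigmax _ (fun ij => `|y ij.1 ij.2|) (0, i)).
Qed.

Lemma rV_norm_le n (y : 'rV[R]_n) r :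
  0 <= r -> (forall i, `|y 0 i| <= r) -> `|y| <= r.
Proof.
move=> r0 yr; rewrite [leLHS]/Num.Def.normr/= mx_normrE.
by apply: bigmax_le => // -[i j] _ /=; rewrite ord1.
Qed.

(* The increment is telescoped along the coordinate axes. *)
Lemma increment_telescope n (f : 'rV[R]_n -> R) (x y : 'rV[R]_n) :
  (forall z, `|z| <= `|y| -> forall i, derivable f (x + z) (delta_mx 0 i)) ->
  exists z : 'I_n -> 'rV[R]_n, (forall i, `|z i| <= `|y|) /\
    f (x + y) - f x = \sum_i y 0 i * 'D_(delta_mx 0 i) f (x + z i).
Proof.
move=> df; pose w (k : nat) : 'rV[R]_n := \row_i (if (i < k)%N then y 0 i else 0).
have wS (k : 'I_n) : w k.+1 = w k + y 0 k *: delta_mx 0 k.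
  apply/rowP => i; rewrite !mxE eqxx ltnS leq_eqVlt -val_eqE/=.
  by case: ltngtP => //= [ik|ik|/val_inj ->]; rewrite ?mulr1 ?mulr0 ?addr0 ?add0r.
have step (k : 'I_n) : exists z : 'rV[R]_n, `|z| <= `|y| /\
    f (x + w k.+1) - f (x + w k) = y 0 k * 'D_(delta_mx 0 k) f (x + z).
  (* The norm is the maximum of the coordinates, so a point whose coordinates are each dominated by
     those of [y] stays in the ball of radius the norm of [y]. *)
  have wc c : `|c| <= `|y 0 k| -> `|w k + c *: delta_mx 0 k| <= `|y|.
    move=> cy; apply: rV_norm_le => // i; rewrite !mxE eqxx/=.
    case: ltngtP => [ik|ik|/val_inj ->].
    - by rewrite -val_eqE (ltn_eqF ik) mulr0 addr0 rV_norm_coord.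
    - by rewrite -val_eqE (gtn_eqF ik) mulr0 addr0 normr0.
    - by rewrite eqxx mulr1 add0r (le_trans cy) ?rV_norm_coord.
  have [|c cy E] := @MVT_line _ f (x + w k) (delta_mx 0 k) (y 0 k).
    by move=> s sy; rewrite -addrA; apply: df; exact: wc.
  exists (w k + c *: delta_mx 0 k); split; first exact: wc.
  by rewrite wS !addrA E.
have [z zP] := choice step.
exists z; split; first by move=> i; have [] := zP i.
have w0 : w 0%N = 0 by apply/rowP => i; rewrite !mxE.
have wn : w n = y by apply/rowP => i; rewrite !mxE ltn_ord.
rewrite -{1}wn -[in f x](addr0 x) -w0.
rewrite -(@telescope_sumr _ 0 n (fun k => f (x + w k))) // big_mkord.
by apply: eq_bigr => i _; have [] := zP i.
Qed.

(** In the telescoped increment each partial derivative is taken at a point near [x]; by continuity,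
    replacing it by its value at [x] costs an error that is small relative to the increment. *)
Lemma differentiable_partials n (f : 'rV[R]_n -> R) x :
  (\forall y \near x, forall i, derivable f y (delta_mx 0 i)) ->
  (forall i, {for x, continuous ('D_(delta_mx 0 i) f)}) ->
  differentiable f x.
Proof.
move=> df cf; pose L := linear_form (fun i => 'D_(delta_mx 0 i) f x).
have fL : f \o shift x = cst (f x) + (L : _ -> R) +o_ 0 id.
  apply/eqaddoP => _/posnumP[e].
  (* There are [n] error terms to share [e]; dividing by [n.+1] also covers [n = 0]. *)
  pose e' := e%:num / n.+1%:R.
  have e'0 : 0 < e' by rewrite divr_gt0.
  have : \forall y \near x, (forall i, derivable f y (delta_mx 0 i)) /\
      (forall i, `|'D_(delta_mx 0 i) f x - 'D_(delta_mx 0 i) f y| <= e').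
    have cf' : \forall y \near x, forall i,
        `|'D_(delta_mx 0 i) f x - 'D_(delta_mx 0 i) f y| <= e'.
      apply: (@filter_forall _ _ (fun i y =>
        `|'D_(delta_mx 0 i) f x - 'D_(delta_mx 0 i) f y| <= e') (nbhs x) _) => i.
      by have /cvgrPdist_le := cf i; apply.
    by near=> y; split; near: y.
  move=> /nbhs_normP[r /= r0 xr]; rewrite /= ?near_simpl.
  apply/nbhs_norm0P; exists r => // y /= yr.
  have near_y (z : 'rV[R]_n) : `|z| <= `|y| -> `|x - (x + z)| < r.
    by move=> zy; rewrite opprD addNKr normrN (le_lt_trans zy).
  have [|z [zy E]] := @increment_telescope _ f x y.
    by move=> z /near_y /xr[].
  have -> : (f \o shift x - (cst (f x) + (L : _ -> R))) y =
      \sum_i y 0 i * ('D_(delta_mx 0 i) f (x + z i) - 'D_(delta_mx 0 i) f x).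
    rewrite -![(_ - _ : _ -> _) _]/(_ - _) -![(_ + _ : _ -> _) _]/(_ + _) /=.
    rewrite opprD addrA (addrC y) E /L /linear_form -sumrB.
    by apply: eq_bigr => i _; rewrite mulrBr.
  rewrite (le_trans (ler_norm_sum _ _ _))//.
  apply: (@le_trans _ _ (\sum_(i < n) `|y| * e')).
    apply: ler_sum => i _; rewrite normrM ler_pM// ?rV_norm_coord// distrC.
    by have /near_y /xr [_ ->] := zy i.
  rewrite sumr_const card_ord -[leLHS]mulr_natr -mulrA mulrC ler_wpM2r//.
  by rewrite /e' mulrAC ler_pdivrMr// ler_wpM2l// ler_nat.
have dE := diff_unique (@continuous_linear_form _ _) fL.
by apply/diff_locallyP; rewrite dE; split=> //; exact: continuous_linear_form.
Unshelve. all: by end_near. Qed.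

(** Only the derivative of [c] along [v] is known, so [c] is restricted to the line [l] through [x].
    A derivable function of one variable is differentiable, and the composition rule for
    differentials then applies to [f \o l]. *)
Lemma is_derive_chain m n (f : 'rV[R]_n -> R) (c : 'rV[R]_m -> 'rV[R]_n)
    (x v : 'rV[R]_m) (dc : 'I_n -> R) :
  differentiable f (c x) ->
  (forall k, is_derive x v (fun y => c y 0 k) (dc k)) ->
  is_derive x v (f \o c) (\sum_k dc k * 'D_(delta_mx 0 k) f (c x)).
Proof.
move=> df ddc.
have dcx : derivable c x v.
  by apply/derivable_mxP => i k; rewrite (ord1 i); have [] := ddc k.
have Dcx : 'D_v c x = \row_k dc k.
  rewrite derive_mx//; apply/matrixP => i k; rewrite !mxE (ord1 i).
  by have [_] := ddc k.
pose l := fun s : R => c (s *: v + x).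
have l0 : l 0 = c x by rewrite /l scale0r add0r.
have dl : differentiable l 0.
  have /derivable1P dcl := dcx.
  by apply/derivable1_diffP.
have dlE : 'd l 0 1 = \row_k dc k.
  rewrite -Dcx -deriveE// /derive; congr (lim _).
  suff -> : (fun h => h^-1 *: ((l \o shift 0) (h *: 1) - l 0)) =
    (fun h => h^-1 *: ((c \o shift x) (h *: v) - c x)) by [].
  by apply/funext => h; rewrite l0 /= /l addr0 [h *: 1]mulr1.
have dfl : differentiable (f \o l) 0.
  by apply: differentiable_comp => //; rewrite l0.
have dfc : derivable (f \o c) x v.
  have /derivable1_diffP dfl1 := dfl.
  by apply/derivable1P.
split=> //.
have -> : 'D_v (f \o c) x = 'D_1 (f \o l) 0.
  rewrite /derive; congr (lim _).
  suff -> : (fun h => h^-1 *: ((f \o l \o shift 0) (h *: 1) - (f \o l) 0)) =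
    (fun h => h^-1 *: ((f \o c \o shift x) (h *: v) - (f \o c) x)) by [].
  by apply/funext => h; rewrite /= l0 /= /l addr0 [h *: 1]mulr1.
rewrite deriveE// diff_comp//= ?l0// dlE.
rewrite (row_sum_delta (\row_k dc k)) linear_sum; apply: eq_bigr => k _.
by rewrite linearZ/= mxE -deriveE.
Qed.

(** Two mean value steps: along [u] for the difference [g] of [f] in direction [v], then along [v]
    for the derivative of [f] in direction [u]. *)
Lemma second_difference (V : normedModType R) (f : V -> R) (x u v : V) (r s : R) :
  (forall y, `|y - x| < r -> derivable f y u /\ derivable ('D_u f) y v) ->
  0 < s -> s * (`|u| + `|v|) < r ->
  exists2 y, `|y - x| < r &
    f (x + s *: u + s *: v) - f (x + s *: u) - f (x + s *: v) + f x =
    s * (s * 'D_v ('D_u f) y).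
Proof.
move=> df s0 sr.
have box c d : `|c| <= `|s| -> `|d| <= `|s| -> `|x + c *: u + d *: v - x| < r.
  move=> cs ds; apply: le_lt_trans sr.
  rewrite -[x + c *: u + _]addrA [x + _]addrC addrK.
  rewrite (le_trans (ler_normD _ _))// mulrDr !normrZ.
  by rewrite -(gtr0_norm s0) lerD// ler_wpM2r// normr_ge0.
have n0 : `|0 : R| <= `|s| by rewrite normr0.
pose g y := f (y + s *: v) - f y.
have dg c : `|c| <= `|s| -> is_derive (x + c *: u) u g
    ('D_u f (x + c *: u + s *: v) - 'D_u f (x + c *: u)).
  move=> cs; apply: is_deriveB.
    apply: (@is_derive_translate _ _ f); apply: derivableP.
    by have [] := df _ (box _ _ cs (lexx _)).
  apply: derivableP; have [] := df _ (box _ _ cs n0).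
  by rewrite scale0r addr0.
have [|c cs Ec] := @MVT_line _ g x u s; first by move=> c /dg[].
have [|d ds Ed] := @MVT_line _ ('D_u f) (x + c *: u) v s.
  by move=> d ds; have [] := df _ (box _ _ cs ds).
exists (x + c *: u + d *: v); first exact: box.
rewrite -Ed -[X in s * X](@derive_val _ _ _ _ _ _ _ (dg _ cs)) -Ec /g.
rewrite [x + s *: u + _]addrAC; ring.
Qed.

Lemma nbhs_norm_radius (V : normedModType R) (x : V) (P : set V) :
  nbhs x P -> exists2 r, 0 < r & forall y, `|y - x| < r -> P y.
Proof.
by move=> /nbhs_normP[r r0 xr]; exists r => // y yr; apply: xr; rewrite /= distrC.
Qed.

Lemma dist_le_half (x y z e : R) :
  `|x - z| <= e / 2 -> `|y - z| <= e / 2 -> `|x - y| <= e.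
Proof.
move=> xz yz.
by rewrite -(subrKA z) (le_trans (ler_normD _ _))// (splitr e) lerD// distrC.
Qed.

(** The second difference is symmetric in [u] and [v], so the two mixed derivatives take a common
    value at two points [y] and [z] of any small ball around [x]; continuity at [x] closes the
    gap. *)
Lemma derive_comm (V : normedModType R) (f : V -> R) (x u v : V) :
  (\forall y \near x, derivable f y u) -> (\forall y \near x, derivable f y v) ->
  (\forall y \near x, derivable ('D_u f) y v) ->
  (\forall y \near x, derivable ('D_v f) y u) ->
  {for x, continuous ('D_v ('D_u f))} -> {for x, continuous ('D_u ('D_v f))} ->
  'D_v ('D_u f) x = 'D_u ('D_v f) x.
Proof.
move=> du dv duv dvu cuv cvu; apply/eqP; rewrite -subr_eq0 -normr_le0.
apply/ler_addgt0Pr => e e0; rewrite add0r.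
have e2 : 0 < e / 2 by rewrite divr_gt0.
have /cvgrPdist_le /(_ _ e2) Hu := cuv; have /cvgrPdist_le /(_ _ e2) Hv := cvu.
have [r r0 xr] := nbhs_norm_radius
  (filterI (filterI (filterI du duv) (filterI dv dvu)) (filterI Hu Hv)).
(* The [+ 1] keeps the denominator positive when [u] and [v] vanish; the step then keeps the whole
   parallelogram inside the ball of radius [r]. *)
pose s := r / (2 * (`|u| + `|v| + 1)).
have d0 : 0 < `|u| + `|v| + 1 by rewrite ltr_wpDl// addr_ge0.
have s0 : 0 < s by rewrite divr_gt0// mulr_gt0.
have sr : s * (`|u| + `|v|) < r.
  rewrite /s mulrAC ltr_pdivrMr ?mulr_gt0// ltr_pM2l//.
  have := normr_ge0 u; have := normr_ge0 v; lra.
have [|y yr Ey] := @second_difference _ f x u v r s _ s0 sr.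
  move=> y /xr[[d _] _]; exact: d.
have [||z zr Ez] := @second_difference _ f x v u r s _ s0 _.
- move=> z /xr[[_ d] _]; exact: d.
- by rewrite (addrC `|v|).
have E : 'D_v ('D_u f) y = 'D_u ('D_v f) z.
  apply: (mulfI (lt0r_neq0 s0)); apply: (mulfI (lt0r_neq0 s0)).
  apply: etrans (esym Ey) (etrans _ Ez); rewrite [x + s *: u + _]addrAC.
  by congr (_ + _); exact: addrAC.
have [_ [yE _]] := xr _ yr; have [_ [_ zE]] := xr _ zr.
exact: dist_le_half yE (eq_ind_r (fun w => `|_ - w| <= _) zE E).
Qed.

End PartialDerivatives.

(** * Partial derivatives of functions on a manifold, read in a chart *)

Section PartialDerivativesInCharts.
Context {R : realType} {m : nat} {M : manifold R m}.
Implicit Types (a : chart M) (p q : M) (U : set M) (f g : M -> R).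

(** [pd] has a value even where no derivative exists. This relation joins existence to value, so
    that derivatives of compound expressions are obtained by composing rules. *)
Definition is_pd a (i : 'I_m) f p (v : R) :=
  is_derive (coord a p) (delta_mx 0 i) (f \o point a) v.

Lemma pd_val a i f p v : is_pd a i f p v -> pd a i f p = v.
Proof. by case. Qed.

Lemma is_pdP a i f p : derivable (f \o point a) (coord a p) (delta_mx 0 i) ->
  is_pd a i f p (pd a i f p).
Proof. exact: derivableP. Qed.

Lemma is_pd_eq a i f p v w : is_pd a i f p v -> v = w -> is_pd a i f p w.
Proof. by move=> ? <-. Qed.

Lemma near_point a p U : dom a p -> nbhs p U ->
  \forall x \near coord a p, U (point a x).
Proof.
move=> ap pU; apply: (point_continuous ap).
by rewrite coordK.
Qed.

(** The image of a chart is open, so every vector close to [coord a p] is again the coordinate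
    vector of a point; this carries pointwise facts on [M] over to neighbourhoods in the model
    space. *)
Lemma near_coord a p U : dom a p -> nbhs p U ->
  \forall x \near coord a p, exists2 q, U q & x = coord a q.
Proof.
move=> ap pU; have ca : \forall x \near coord a p, (coord a @` dom a) x.
  by apply: open_nbhs_nbhs; split; [exact: image_open|exists p].
near=> x; have [q aq qx] : (coord a @` dom a) x by near: x.
exists q => //; rewrite -(coordK aq) qx.
by near: x; exact: near_point.
Unshelve. all: by end_near. Qed.

Lemma near_is_pd a i f g p v : dom a p -> (\forall q \near p, f q = g q) ->
  is_pd a i f p v -> is_pd a i g p v.
Proof.
move=> ap fg; apply: near_eq_is_derive.
exact: (@near_point _ _ (fun q => f q = g q)).
Qed.

Lemma near_pd a i f g p : dom a p -> (\forall q \near p, f q = g q) ->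
  pd a i f p = pd a i g p.
Proof.
move=> ap fg; apply: near_eq_derive.
exact: (@near_point _ _ (fun q => f q = g q)).
Qed.

Lemma is_pd_cst a i p c : is_pd a i (cst c) p 0.
Proof. exact: is_derive_cst. Qed.

Lemma is_pdD a i f g p v w : is_pd a i f p v -> is_pd a i g p w ->
  is_pd a i (fun q => f q + g q) p (v + w).
Proof. exact: is_deriveD. Qed.

Lemma is_pdN a i f p v : is_pd a i f p v -> is_pd a i (fun q => - f q) p (- v).
Proof. exact: is_deriveN. Qed.

Lemma is_pdB a i f g p v w : is_pd a i f p v -> is_pd a i g p w ->
  is_pd a i (fun q => f q - g q) p (v - w).
Proof. exact: is_deriveB. Qed.

Lemma is_pdM a i f g p v w : dom a p -> is_pd a i f p v -> is_pd a i g p w ->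
  is_pd a i (fun q => f q * g q) p (v * g p + f p * w).
Proof.
move=> ap fv gw; have /is_derive_eq := is_deriveM fv gw; apply.
by rewrite /= coordK// addrC; congr (_ + _); rewrite mulrC.
Qed.

Lemma is_pdZ a i f p v c : dom a p -> is_pd a i f p v ->
  is_pd a i (fun q => c * f q) p (c * v).
Proof.
move=> ap fv; apply: is_pd_eq (is_pdM ap (is_pd_cst a i p c) fv) _.
by rewrite mul0r add0r.
Qed.

Lemma is_pd_sum a i p n (F : 'I_n -> M -> R) v :
  (forall k, is_pd a i (F k) p (v k)) ->
  is_pd a i (fun q => \sum_k F k q) p (\sum_k v k).
Proof.
move=> Fv; have := is_derive_sum Fv; rewrite /is_pd.
suff -> : \sum_(k < n) (F k \o point a) = (fun q => \sum_k F k q) \o point a by [].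
by apply/funext => x; rewrite fct_sumE.
Qed.

Lemma is_pdV a i f p v : dom a p -> f p != 0 -> is_pd a i f p v ->
  is_pd a i (fun q => (f q)^-1) p (- (f p * f p)^-1 * v).
Proof.
move=> ap f0 [df <-].
have f0' : (f \o point a) (coord a p) != 0 by rewrite /= coordK.
split; first exact: (@derivableV _ _ (f \o point a)).
by rewrite (@deriveV _ _ (f \o point a))//= coordK.
Qed.

(** Only a local equality: [pd] differentiates at [coord a (point a x)], which is known to be [x]
    only on the image of the chart. *)
Lemma near_derive_pd a i f p : dom a p ->
  \forall x \near coord a p,
    'D_(delta_mx 0 i) (f \o point a) x = (pd a i f \o point a) x.
Proof.
move=> ap; have aU : nbhs p (dom a).
  by apply: open_nbhs_nbhs; split=> //; exact: dom_open.
near=> x; have [q aq ->] : exists2 q, dom a q & x = coord a q.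
  by near: x; exact: near_coord.
by rewrite /= coordK.
Unshelve. all: by end_near. Qed.

End PartialDerivativesInCharts.

(** * Stability of the classes C^k, and what C^1 and C^2 imply *)

Section DifferentiabilityClasses.
Context {R : realType} {m : nat} {M : manifold R m} (a : chart M) (U : set M).
Hypotheses (oU : open U) (Ua : U `<=` dom a).
Implicit Types (p q : M) (f g : M -> R) (k : nat).

Let nU p : U p -> nbhs p U.
Proof. by move=> Up; apply: open_nbhs_nbhs. Qed.

Lemma Ck_continuous k f p : Ck a U k f -> U p -> {for p, continuous f}.
Proof. by case: k => [|k] [cf _]; exact: cf. Qed.

Lemma Ck_is_pd k f i p : Ck a U k.+1 f -> U p -> is_pd a i f p (pd a i f p).
Proof. by move=> [_ /(_ i)[df _]] Up; apply: is_pdP; exact: df. Qed.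

Lemma Ck_pd k f i : Ck a U k.+1 f -> Ck a U k (pd a i f).
Proof. by move=> [_ /(_ i)[]]. Qed.

Lemma CkW k f : Ck a U k.+1 f -> Ck a U k f.
Proof.
elim: k f => [|k ih] f [cf df]; split=> // i.
by have [dfi Cfi] := df i; split=> //; exact: ih.
Qed.

(** On an open set, agreement on [U] is agreement near each of its points and so passes to
    derivatives. The inductions below use it to replace a partial derivative by its Leibniz formula,
    which is known on [U] only. *)
Lemma eq_Ck k f g : (forall p, U p -> f p = g p) -> Ck a U k f -> Ck a U k g.
Proof.
have nfg f' g' p : (forall p, U p -> f' p = g' p) -> U p ->
    \forall q \near p, f' q = g' q.
  by move=> fg Up; apply: filterS (nU Up) => q /fg.
have cfg f' g' p : (forall p, U p -> f' p = g' p) -> U p ->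
    {for p, continuous f'} -> {for p, continuous g'}.
  move=> fg Up; rewrite /prop_for /continuous_at (fg _ Up) => cf.
  by apply: cvg_trans cf; apply: near_eq_cvg; exact: nfg.
elim: k f g => [|k ih] f g fg [cf df]; split=> //.
- by move=> p Up; exact: cfg fg Up (cf _ Up).
- by move=> p Up; exact: cfg fg Up (cf _ Up).
- move=> i; have [dfi Cfi] := df i; split.
    move=> p Up.
    by have [] := near_is_pd (Ua Up) (nfg _ _ _ fg Up) (is_pdP (dfi _ Up)).
  by apply: ih Cfi => p Up; apply: near_pd; [exact: Ua|exact: nfg].
Qed.

Lemma Ck_cst k c : Ck a U k (cst c).
Proof.
elim: k c => [|k ih] c; split=> //; try by move=> p _; exact: cst_continuous.
move=> i; split=> [p Up|]; first by have [] := is_pd_cst a i p c.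
by apply: eq_Ck (ih 0) => p _; rewrite (pd_val (is_pd_cst _ _ _ _)).
Qed.

Lemma CkD k f g : Ck a U k f -> Ck a U k g -> Ck a U k (fun q => f q + g q).
Proof.
elim: k f g => [|k ih] f g Cf Cg; split=> //;
  try by move=> p Up; apply: (@continuousD _ _ _ f g);
         [exact: Ck_continuous Cf Up|exact: Ck_continuous Cg Up].
have D i p (Up : U p) := is_pdD (Ck_is_pd i Cf Up) (Ck_is_pd i Cg Up).
move=> i; split=> [p Up|]; first by have [] := D i _ Up.
apply: eq_Ck (ih _ _ (Ck_pd i Cf) (Ck_pd i Cg)) => p Up.
by rewrite (pd_val (D i _ Up)).
Qed.

Lemma CkM k f g : Ck a U k f -> Ck a U k g -> Ck a U k (fun q => f q * g q).
Proof.
elim: k f g => [|k ih] f g Cf Cg; split=> //;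
  try by move=> p Up; apply: (@continuousM _ _ f g);
         [exact: Ck_continuous Cf Up|exact: Ck_continuous Cg Up].
have D i p (Up : U p) := is_pdM (Ua Up) (Ck_is_pd i Cf Up) (Ck_is_pd i Cg Up).
move=> i; split=> [p Up|]; first by have [] := D i _ Up.
apply: eq_Ck (CkD (ih _ _ (Ck_pd i Cf) (CkW Cg))
  (ih _ _ (CkW Cf) (Ck_pd i Cg))) => p Up.
by rewrite (pd_val (D i _ Up)).
Qed.

Lemma CkZ k f c : Ck a U k f -> Ck a U k (fun q => c * f q).
Proof. exact: (CkM (Ck_cst k c)). Qed.

Lemma CkN k f : Ck a U k f -> Ck a U k (fun q => - f q).
Proof. by move=> /(CkZ (-1)); apply: eq_Ck => p _; rewrite mulN1r. Qed.

Lemma CkB k f g : Ck a U k f -> Ck a U k g -> Ck a U k (fun q => f q - g q).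
Proof. by move=> Cf /CkN; exact: CkD. Qed.

Lemma Ck_sum k (I : finType) (F : I -> M -> R) :
  (forall i, Ck a U k (F i)) -> Ck a U k (fun q => \sum_i F i q).
Proof.
move=> CF; elim: (index_enum I) => [|i s ih].
  by apply: eq_Ck (Ck_cst k 0) => p _; rewrite big_nil.
by apply: eq_Ck (CkD (CF i) ih) => p _; rewrite big_cons.
Qed.

Lemma Ck_prod k (I : finType) (F : I -> M -> R) :
  (forall i, Ck a U k (F i)) -> Ck a U k (fun q => \prod_i F i q).
Proof.
move=> CF; elim: (index_enum I) => [|i s ih].
  by apply: eq_Ck (Ck_cst k 1) => p _; rewrite big_nil.
by apply: eq_Ck (CkM (CF i) ih) => p _; rewrite big_cons.
Qed.

Lemma CkV k f : (forall p, U p -> f p != 0) -> Ck a U k f ->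
  Ck a U k (fun q => (f q)^-1).
Proof.
move=> f0; elim: k => [|k ih] Cf; split=> //;
  try by move=> p Up; apply: cvgV; [exact: f0|exact: Ck_continuous Cf Up].
have D i p (Up : U p) := is_pdV (Ua Up) (f0 _ Up) (Ck_is_pd i Cf Up).
move=> i; split=> [p Up|]; first by have [] := D i _ Up.
have Cf' := ih (CkW Cf).
apply: eq_Ck (CkM (CkN (CkM Cf' Cf')) (Ck_pd i Cf)) => p Up.
by rewrite (pd_val (D i _ Up)) invfM.
Qed.

Lemma Ck_det k n (A : M -> 'M[R]_n) :
  (forall i j, Ck a U k (fun q => A q i j)) -> Ck a U k (fun q => \det (A q)).
Proof.
move=> CA; apply: Ck_sum => s; apply: CkZ.
by apply: Ck_prod => i; exact: CA.
Qed.

(** By Cramer's rule the entries of the inverse are polynomials in the entries divided by the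
    determinant. This gives the smoothness of the inverse metric, hence of the Christoffel
    symbols. *)
Lemma Ck_invmx k n (A : M -> 'M[R]_n) :
  (forall p, U p -> A p \in unitmx) ->
  (forall i j, Ck a U k (fun q => A q i j)) ->
  forall i j, Ck a U k (fun q => invmx (A q) i j).
Proof.
move=> uA CA i j.
have Cadj : Ck a U k (fun q => \adj (A q) i j).
  have Cc : Ck a U k (fun q => cofactor (A q) j i).
    apply: CkZ; apply: Ck_det => i' j'.
    apply: (@eq_Ck k (fun q => A q (fintype.lift j i') (fintype.lift i j')));
      last exact: CA.
    by move=> p _; rewrite !mxE.
  by apply: eq_Ck Cc => p _; rewrite mxE.
have Cdet := Ck_det CA.
have d0 p : U p -> \det (A p) != 0 by move=> /uA; rewrite unitmxE unitfE.
apply: eq_Ck (CkM (CkV d0 Cdet) Cadj) => p Up.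
by rewrite /invmx uA// [RHS]mxE.
Qed.

Lemma Ck_differentiable f p : Ck a U 1 f -> U p ->
  differentiable (f \o point a) (coord a p).
Proof.
move=> Cf Up; apply: differentiable_partials.
  near=> x => i; have [q Uq ->] : exists2 q, U q & x = coord a q.
    by near: x; apply: near_coord; [exact: Ua|exact: nU].
  by have [] := Ck_is_pd i Cf Uq.
move=> i; rewrite /prop_for /continuous_at -/(pd a i f p).
have c : (pd a i f \o point a) x @[x --> coord a p] --> pd a i f p.
  apply: (@cvg_comp _ _ _ _ _ _ (nbhs p)).
    have := point_continuous (Ua Up).
    by rewrite /prop_for /continuous_at coordK//; exact: Ua.
  exact: Ck_continuous (Ck_pd i Cf) Up.
have e : \forall x \near coord a p,
    (pd a i f \o point a) x = 'D_(delta_mx 0 i) (f \o point a) x.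
  by near=> x; apply/esym; near: x; apply: near_derive_pd; exact: Ua.
exact: cvg_trans (near_eq_cvg e) c.
Unshelve. all: by end_near. Qed.

Lemma pd_comm f p i j : Ck a U 2 f -> U p ->
  pd a i (pd a j f) p = pd a j (pd a i f) p.
Proof.
move=> Cf Up; have ap := Ua Up.
have pd2 q (k l : 'I_m) : U q -> is_derive (coord a q) (delta_mx 0 k)
    ('D_(delta_mx 0 l) (f \o point a)) (pd a k (pd a l f) q).
  move=> Uq; apply: near_eq_is_derive (Ck_is_pd k (Ck_pd l Cf) Uq).
  by near=> x; apply/esym; near: x; apply: near_derive_pd; exact: Ua.
have nx : \forall x \near coord a p, exists2 q, U q & x = coord a q.
  by apply: near_coord => //; exact: nU.
have d1 (k : 'I_m) : \forall x \near coord a p, derivable (f \o point a) x (delta_mx 0 k).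
  by apply: filterS nx => _ [q Uq ->]; have [] := Ck_is_pd k Cf Uq.
have d2 (k l : 'I_m) : \forall x \near coord a p,
    derivable ('D_(delta_mx 0 l) (f \o point a)) x (delta_mx 0 k).
  by apply: filterS nx => _ [q Uq ->]; have [] := pd2 q k l Uq.
have c2 (k l : 'I_m) : {for coord a p, continuous
    ('D_(delta_mx 0 k) ('D_(delta_mx 0 l) (f \o point a)))}.
  rewrite /prop_for /continuous_at (@derive_val _ _ _ _ _ _ _ (pd2 p k l Up)).
  have c : (pd a k (pd a l f) \o point a) x @[x --> coord a p] --> pd a k (pd a l f) p.
    apply: (@cvg_comp _ _ _ _ _ _ (nbhs p)).
      by have := point_continuous ap; rewrite /prop_for /continuous_at coordK.
    exact: Ck_continuous (Ck_pd k (Ck_pd l Cf)) Up.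
  have e : \forall x \near coord a p, (pd a k (pd a l f) \o point a) x =
      'D_(delta_mx 0 k) ('D_(delta_mx 0 l) (f \o point a)) x.
    apply: filterS nx => _ [q Uq ->].
    by rewrite (@derive_val _ _ _ _ _ _ _ (pd2 q k l Uq))/= coordK//; exact: Ua.
  exact: cvg_trans (near_eq_cvg e) c.
rewrite -(@derive_val _ _ _ _ _ _ _ (pd2 p i j Up)).
rewrite -(@derive_val _ _ _ _ _ _ _ (pd2 p j i Up)).
exact: derive_comm.
Unshelve. all: by end_near. Qed.

End DifferentiabilityClasses.

(** By continuity [phi] keeps a neighbourhood of [p] inside [V], where [F] factors through the chart
    [b]; the chain rule between coordinate spaces then applies. *)
Lemma is_pd_comp (R : realType) m n (M : manifold R m) (N : manifold R n)
    (phi : M -> N) (a : chart M) (b : chart N) V F mu p :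
  dom a p -> {for p, continuous phi} ->
  open V -> V `<=` dom b -> V (phi p) -> Ck b V 1 F ->
  (forall k, derivable ((fun q => coord b (phi q) 0 k) \o point a) (coord a p)
     (delta_mx 0 mu)) ->
  is_pd a mu (F \o phi) p (\sum_k dphi phi a b mu k p * pd b k F (phi p)).
Proof.
move=> ap cphi oV Vb Vp CF dphi'.
pose c x := coord b (phi (point a x)).
have dF : differentiable (F \o point b) (c (coord a p)).
  by rewrite /c coordK//; exact: Ck_differentiable CF Vp.
have := is_derive_chain dF (fun k => derivableP (dphi' k)).
have -> : \sum_k 'D_(delta_mx 0 mu) ((fun q => coord b (phi q) 0 k) \o point a)
     (coord a p) * 'D_(delta_mx 0 k) (F \o point b) (c (coord a p)) =
   \sum_k dphi phi a b mu k p * pd b k F (phi p).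
  by apply: eq_bigr => k _; rewrite /c coordK.
apply: near_eq_is_derive.
have nV : nbhs p (phi @^-1` V) by apply: cphi; apply: open_nbhs_nbhs.
near=> x; rewrite /= /c coordK//; apply: Vb.
by near: x; apply: (near_point ap nV).
Unshelve. all: by end_near. Qed.

(** * The same rules for complex-valued functions, through real and imaginary parts *)

Section ComplexPartialDerivatives.
Context {R : realType} {m : nat} {M : manifold R m}.
Implicit Types (a : chart M) (p q : M) (f g : M -> R[i]).

Definition is_pdC a (i : 'I_m) f p (v : R[i]) :=
  is_pd a i (fun q => complex.Re (f q)) p (complex.Re v) /\
  is_pd a i (fun q => complex.Im (f q)) p (complex.Im v).

Lemma pdC_val a i f p v : is_pdC a i f p v -> pdC a i f p = v.
Proof. by rewrite /pdC => -[/pd_val -> /pd_val ->]; case: v. Qed.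

Lemma is_pdC_eq a i f p v w : is_pdC a i f p v -> v = w -> is_pdC a i f p w.
Proof. by move=> ? <-. Qed.

Lemma eq_is_pdC a i f g p v : f =1 g -> is_pdC a i f p v -> is_pdC a i g p v.
Proof. by move=> /funext ->. Qed.

Lemma is_pdC_cst a i p c : is_pdC a i (cst c) p 0.
Proof. by split; exact: is_pd_cst. Qed.

Lemma is_pdC_real a i (f : M -> R) p v : is_pd a i f p v ->
  is_pdC a i (fun q => (f q)%:C) p v%:C.
Proof. by move=> fv; split=> //; exact: is_pd_cst. Qed.

Lemma is_pdCJ a i f p v : is_pdC a i f p v ->
  is_pdC a i (fun q => conjc (f q)) p (conjc v).
Proof.
move=> [fr fi]; split.
  have -> : (fun q => complex.Re (conjc (f q))) = (fun q => complex.Re (f q)).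
    by apply/funext => q; case: (f q).
  by case: v fr {fi}.
have -> : (fun q => complex.Im (conjc (f q))) = (fun q => - complex.Im (f q)).
  by apply/funext => q; case: (f q).
by move: fi => /is_pdN; case: v {fr}.
Qed.

Lemma is_pdCD a i f g p v w : is_pdC a i f p v -> is_pdC a i g p w ->
  is_pdC a i (fun q => f q + g q) p (v + w).
Proof.
move=> [fr fi] [gr gi]; split.
  have -> : (fun q => complex.Re (f q + g q)) =
      (fun q => complex.Re (f q) + complex.Re (g q)).
    by apply/funext => q; case: (f q); case: (g q).
  by have := is_pdD fr gr; case: v {fr fi} => ? ?; case: w {gr gi}.
have -> : (fun q => complex.Im (f q + g q)) =
    (fun q => complex.Im (f q) + complex.Im (g q)).
  by apply/funext => q; case: (f q); case: (g q).
by have := is_pdD fi gi; case: v {fr fi} => ? ?; case: w {gr gi}.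
Qed.

Lemma is_pdCM a i f g p v w : dom a p -> is_pdC a i f p v -> is_pdC a i g p w ->
  is_pdC a i (fun q => f q * g q) p (v * g p + f p * w).
Proof.
move=> ap [fr fi] [gr gi]; split.
  have -> : (fun q => complex.Re (f q * g q)) = (fun q => complex.Re (f q) *
      complex.Re (g q) - complex.Im (f q) * complex.Im (g q)).
    by apply/funext => q; case: (f q) => ? ?; case: (g q).
  apply: is_pd_eq (is_pdB (is_pdM ap fr gr) (is_pdM ap fi gi)) _.
  by case: v {fr fi} => ? ?; case: w {gr gi} => ? ?;
    case: (f p) => ? ?; case: (g p) => ? ? /=; ring.
have -> : (fun q => complex.Im (f q * g q)) = (fun q => complex.Re (f q) *
    complex.Im (g q) + complex.Im (f q) * complex.Re (g q)).
  by apply/funext => q; case: (f q) => ? ?; case: (g q).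
apply: is_pd_eq (is_pdD (is_pdM ap fr gi) (is_pdM ap fi gr)) _.
by case: v {fr fi} => ? ?; case: w {gr gi} => ? ?;
  case: (f p) => ? ?; case: (g p) => ? ? /=; ring.
Qed.

Lemma is_pdCZ a i f p v c : dom a p -> is_pdC a i f p v ->
  is_pdC a i (fun q => c * f q) p (c * v).
Proof.
move=> ap fv; apply: is_pdC_eq (is_pdCM ap (is_pdC_cst a i p c) fv) _.
by rewrite mul0r add0r.
Qed.

Lemma is_pdCB a i f g p v w : dom a p -> is_pdC a i f p v -> is_pdC a i g p w ->
  is_pdC a i (fun q => f q - g q) p (v - w).
Proof.
move=> ap fv gw; have := is_pdCD fv (is_pdCZ (-1) ap gw); rewrite mulN1r.
by apply: eq_is_pdC => q; rewrite mulN1r.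
Qed.

Lemma is_pdC_sum a i p n (F : 'I_n -> M -> R[i]) v :
  (forall k, is_pdC a i (F k) p (v k)) ->
  is_pdC a i (fun q => \sum_k F k q) p (\sum_k v k).
Proof.
move=> Fv; elim: (index_enum _) => [|k s ih].
  rewrite big_nil; apply: eq_is_pdC (is_pdC_cst a i p 0) => q.
  by rewrite big_nil.
by rewrite big_cons; apply: eq_is_pdC (is_pdCD (Fv k) ih) => q; rewrite big_cons.
Qed.

Lemma smoothC_is_pdC a i f p (U : set M) : smoothC_on U f -> U p -> dom a p ->
  is_pdC a i f p (pdC a i f p).
Proof.
move=> [fr fi] Up ap; split; [exact: (Ck_is_pd _ (fr a 1%N))|].
exact: (Ck_is_pd _ (fi a 1%N)).
Qed.

Lemma is_pdC_mulmx a i p k l (A : 'M[R[i]]_(k, l)) (u : M -> 'cV[R[i]]_l)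
    (v : 'cV[R[i]]_l) r :
  dom a p -> (forall s, is_pdC a i (fun q => u q s 0) p (v s 0)) ->
  is_pdC a i (fun q => (A *m u q) r 0) p ((A *m v) r 0).
Proof.
move=> ap uv; rewrite mxE.
apply: (@eq_is_pdC _ _ (fun q => \sum_s A r s * u q s 0)).
  by move=> q; rewrite mxE.
by apply: is_pdC_sum => s; exact: is_pdCZ.
Qed.

Lemma is_pdC_herm a i p d (u w : M -> 'cV[R[i]]_d)
    (du dw : 'cV[R[i]]_d) : dom a p ->
  (forall s, is_pdC a i (fun q => u q s 0) p (du s 0)) ->
  (forall s, is_pdC a i (fun q => w q s 0) p (dw s 0)) ->
  is_pdC a i (fun q => herm (u q) (w q)) p (herm du (w p) + herm (u p) dw).
Proof.
move=> ap Hu Hw; rewrite /herm -big_split/=; apply: is_pdC_sum => s.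
by apply: is_pdCM => //; exact: is_pdCJ.
Qed.

End ComplexPartialDerivatives.

Lemma sum_delta_l (R : pzRingType) n (F : 'I_n -> R) k :
  \sum_l (k == l)%:R * F l = F k.
Proof.
rewrite (bigD1 k)//= eqxx mul1r big1 ?addr0// => l lk.
by rewrite eq_sym (negbTE lk) mul0r.
Qed.

(** * Index identities of Riemannian geometry as pure algebra *)

Section TensorAlgebra.
Variables (R : realFieldType) (m : nat).
Implicit Types (i j k l q r : 'I_m).

(** [G] and [L] are the values at a point of the Christoffel symbols and of a covector, [dG] and
    [dL] their derivatives. The second derivative is one letter [ddL] for both orders and cancels,
    as does the connection term on the pair [k], [i] by symmetry of [G]; curvature is all that
    remains. *)
Lemma ricci_algebra (G : 'I_m -> 'I_m -> 'I_m -> R)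
    (dG : 'I_m -> 'I_m -> 'I_m -> 'I_m -> R) (L : 'I_m -> R)
    (dL : 'I_m -> 'I_m -> R) ddL k i j :
  (forall l r s, G l r s = G l s r) ->
  let S r s := dL r s - \sum_q G q r s * L q in
  let dS r s ddL := ddL - (\sum_q dG r q s j * L q + \sum_q G q s j * dL r q) in
  (dS k i ddL - \sum_l G l k i * S l j - \sum_l G l k j * S i l) -
  (dS i k ddL - \sum_l G l i k * S l j - \sum_l G l i j * S k l) =
  - \sum_l (dG k l i j - dG i l k j
            + \sum_q (G l k q * G q i j - G l i q * G q k j)) * L l.
Proof.
move=> Gsym S dS; rewrite /dS.
have -> : \sum_l G l i k * S l j = \sum_l G l k i * S l j.
  by apply: eq_bigr => l _; rewrite Gsym.
have splitS r s : \sum_l G l r j * S s l = \sum_l G l r j * dL s l -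
    \sum_q (\sum_l G q s l * G l r j) * L q.
  rewrite /S; under eq_bigr => l _ do rewrite mulrBr mulr_sumr.
  rewrite sumrB; congr (_ - _); rewrite exchange_big/=.
  apply: eq_bigr => q _; rewrite mulr_suml; apply: eq_bigr => l _; ring.
rewrite !splitS.
have -> : \sum_l (dG k l i j - dG i l k j
       + \sum_q (G l k q * G q i j - G l i q * G q k j)) * L l =
    \sum_l dG k l i j * L l - \sum_l dG i l k j * L l +
    (\sum_q (\sum_l G q k l * G l i j) * L q -
     \sum_q (\sum_l G q i l * G l k j) * L q).
  rewrite -!sumrB -big_split/=; apply: eq_bigr => l _; rewrite sumrB; ring.
ring.
Qed.

(** As in Koszul's formula: the three cyclic instances of the commutation rule and the three
    antisymmetries form a linear system that determines [T]. *)
Lemma killing_algebra (T : 'I_m -> 'I_m -> 'I_m -> R) (g : 'I_m -> 'I_m -> R)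
    (L : 'I_m -> R) (K : R) :
  (forall i j, g i j = g j i) -> (forall k i j, T k i j = - T k j i) ->
  (forall k i j, T k i j - T i k j = - (K * (L k * g i j - L i * g k j))) ->
  forall k i j, T k i j = K * (L i * g k j - L j * g k i).
Proof.
move=> gC TN Tg k i j.
have R1 := Tg k i j; have R2 := Tg i j k; have R3 := Tg j k i.
have N1 := TN k i j; have N2 := TN i j k; have N3 := TN j k i.
(* A single index order for [g], so that symmetric entries become one atom for [lra]. *)
rewrite !(gC j i) !(gC j k) !(gC i k) in R1 R2 R3 *.
lra.
Qed.

(** The curvature tensor is here a polynomial in the metric, and [dg] is the derivative of the
    metric as dictated by compatibility; the identity expresses that this polynomial is parallel. *)
Lemma nabla_curv_algebra (G : 'I_m -> 'I_m -> R) (g : 'I_m -> 'I_m -> R) K i j k l :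
  let dg r s := \sum_q G q r * g q s + \sum_q G q s * g r q in
  let C i j k l := K * (g i k * g j l - g i l * g j k) in
  K * (dg i k * g j l + g i k * dg j l - (dg i l * g j k + g i l * dg j k)) =
  \sum_q (G q i * C q j k l + G q j * C i q k l + G q k * C i j q l
          + G q l * C i j k q).
Proof.
move=> dg C; rewrite /dg -!big_split/= !mulr_suml !mulr_sumr -!big_split/= -sumrB.
rewrite mulr_sumr; apply: eq_bigr => q _; rewrite /C; ring.
Qed.

(** The Leibniz rule for the inner product of two vector fields: by [dhE], the Christoffel terms on
    the left are exactly the contribution of the derivative of [h]. *)
Lemma frame_product_algebra (h dh G : 'I_m -> 'I_m -> R) (e f de df : 'I_m -> R) :
  (forall i j, h i j = h j i) ->
  (forall i j, dh i j = \sum_q G q i * h q j + \sum_q G q j * h i q) ->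
  \sum_i \sum_j h i j * (de i + \sum_k G i k * e k) * f j +
  \sum_i \sum_j h i j * (df i + \sum_k G i k * f k) * e j =
  \sum_i \sum_j ((dh i j * e i + h i j * de i) * f j + h i j * e i * df j).
Proof.
move=> hC dhE.
have S1 : \sum_i \sum_j (\sum_q G q i * h q j) * e i * f j =
    \sum_i \sum_j h i j * (\sum_k G i k * e k) * f j.
  under eq_bigr => i _ do under eq_bigr => j _ do rewrite !mulr_suml.
  under [RHS]eq_bigr => i _ do under eq_bigr => j _ do rewrite mulr_sumr mulr_suml.
  rewrite [RHS]exchange_big/=; under [RHS]eq_bigr => j _ do rewrite exchange_big/=.
  rewrite [RHS]exchange_big/=.
  by do 3![apply: eq_bigr => ? _]; ring.
have S2 : \sum_i \sum_j (\sum_q G q j * h i q) * e i * f j =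
    \sum_i \sum_j h i j * (\sum_k G i k * f k) * e j.
  under eq_bigr => i _ do under eq_bigr => j _ do rewrite !mulr_suml.
  under [RHS]eq_bigr => i _ do under eq_bigr => j _ do rewrite mulr_sumr mulr_suml.
  rewrite [RHS]exchange_big/=; under [RHS]eq_bigr => j _ do rewrite exchange_big/=.
  by apply: eq_bigr => i _; apply: eq_bigr => j _; apply: eq_bigr => q _;
    rewrite (hC q i); ring.
have S3 : \sum_i \sum_j h i j * e i * df j = \sum_i \sum_j h i j * df i * e j.
  rewrite exchange_big/=; apply: eq_bigr => i _; apply: eq_bigr => j _.
  by rewrite (hC j i); ring.
transitivity ((\sum_i \sum_j h i j * de i * f j +
    \sum_i \sum_j h i j * (\sum_k G i k * e k) * f j) +
   (\sum_i \sum_j h i j * df i * e j +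
    \sum_i \sum_j h i j * (\sum_k G i k * f k) * e j)).
  by congr (_ + _); rewrite -big_split; apply: eq_bigr => i _;
    rewrite -big_split; apply: eq_bigr => j _; rewrite mulrDr mulrDl.
rewrite -S1 -S2 -S3 -!big_split; apply: eq_bigr => i _.
rewrite -!big_split; apply: eq_bigr => j _; rewrite dhE /=; ring.
Qed.

End TensorAlgebra.

(** * The Levi-Civita connection, Killing fields and constant curvature *)

Section LeviCivitaIdentities.
Context {R : realType} {m : nat} {M : manifold R m} (g : metric M) (a : chart M).
Implicit Types (p : M) (i j k l q r s : 'I_m) (X : chart M -> M -> 'rV[R]_m).

Let oa : open (dom a). Proof. exact: dom_open. Qed.
Let aa : dom a `<=` dom a. Proof. by []. Qed.

Lemma metricC p i j : dom a p -> g a p i j = g a p j i.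
Proof. by move=> ap; rewrite -[in LHS](metric_sym g ap) mxE. Qed.

Lemma metric_unit p : dom a p -> g a p \in unitmx.
Proof.
move=> ap; rewrite unitmxE unitfE; apply/det0P => -[v v0 vg].
by have := metric_posdef g ap v0; rewrite vg mul0mx mxE ltxx.
Qed.

Lemma metric_Ck n i j : Ck a (dom a) n (fun p => g a p i j).
Proof. by have := metric_smooth g a i j a n; rewrite setIid. Qed.

Lemma metric_pdC p r i j : dom a p ->
  pd a r (fun x => g a x i j) p = pd a r (fun x => g a x j i) p.
Proof.
move=> ap; apply: near_pd => //; have := @open_nbhs_nbhs _ p _ (conj oa ap).
by apply: filterS => q; exact: metricC.
Qed.

Lemma christoffel_Ck n k i j : Ck a (dom a) n (christoffel g a k i j).
Proof.
apply: CkZ => //; apply: Ck_sum => // l; apply: CkM => //.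
  by apply: Ck_invmx => // *; [exact: metric_unit|exact: metric_Ck].
have dg r s q := Ck_pd q (metric_Ck n.+1 r s).
by apply: CkB => //; apply: CkD.
Qed.

Lemma christoffelC p k i j : dom a p ->
  christoffel g a k i j p = christoffel g a k j i p.
Proof.
move=> ap; congr (_ * _); apply: eq_bigr => l _; congr (_ * _).
by rewrite [pd a l _ _]metric_pdC// [X in X - _]addrC.
Qed.

Lemma sum_metric_inv p i j : dom a p ->
  \sum_q g a p i q * invmx (g a p) q j = (i == j)%:R.
Proof.
by move=> ap; have /matrixP/(_ i j) := mulmxV (metric_unit ap); rewrite !mxE.
Qed.

Lemma sum_inv_metric p i j : dom a p ->
  \sum_q invmx (g a p) i q * g a p q j = (i == j)%:R.
Proof.
by move=> ap; have /matrixP/(_ i j) := mulVmx (metric_unit ap); rewrite !mxE.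
Qed.

Lemma christoffel_lower p l i j : dom a p ->
  \sum_q g a p l q * christoffel g a q i j p =
  2^-1 * (pd a i (fun x => g a x j l) p + pd a j (fun x => g a x i l) p
          - pd a l (fun x => g a x i j) p).
Proof.
move=> ap; rewrite /christoffel.
set E := fun l => pd a i (fun x => g a x j l) p + pd a j (fun x => g a x i l) p
          - pd a l (fun x => g a x i j) p.
rewrite -/(E l) -(sum_delta_l E l) mulr_sumr.
under eq_bigr => q _ do rewrite mulrCA !mulr_sumr.
rewrite exchange_big/=; apply: eq_bigr => s _.
rewrite -(sum_metric_inv _ _ ap) mulr_suml mulr_sumr.
by apply: eq_bigr => q _; rewrite !mulrA.
Qed.

Lemma metric_compat p r i j : dom a p ->
  pd a r (fun x => g a x i j) p =
  \sum_q christoffel g a q r i p * g a p q j +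
  \sum_q christoffel g a q r j p * g a p i q.
Proof.
move=> ap.
have -> : \sum_q christoffel g a q r i p * g a p q j =
    \sum_q g a p j q * christoffel g a q r i p.
  by apply: eq_bigr => q _; rewrite mulrC (metricC _ _ ap).
have -> : \sum_q christoffel g a q r j p * g a p i q =
    \sum_q g a p i q * christoffel g a q r j p.
  by apply: eq_bigr => q _; rewrite mulrC.
rewrite !christoffel_lower// (metric_pdC r j i ap); lra.
Qed.

(* (nabla_k nabla_i X)_j *)
Definition nabla2_lower X k i j p : R :=
  pd a k (nabla_lower g X a i j) p
  - \sum_l christoffel g a l k i p * nabla_lower g X a l j p
  - \sum_l christoffel g a l k j p * nabla_lower g X a i l p.

Section KillingField.
Variable X : chart M -> M -> 'rV[R]_m.
Hypothesis vX : vector_field_on setT X.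

Lemma lower_Ck n j : Ck a (dom a) n (lower g X a j).
Proof.
apply: Ck_sum => // k; apply: CkM => //; first exact: metric_Ck.
by have := vX.1 a k a n; rewrite setTI setIid.
Qed.

Lemma nabla_lower_Ck n i j : Ck a (dom a) n (nabla_lower g X a i j).
Proof.
apply: CkB => //; first exact: Ck_pd (lower_Ck n.+1 j).
by apply: Ck_sum => // k; apply: CkM => //; [exact: christoffel_Ck|exact: lower_Ck].
Qed.

Lemma pd_nabla_lower p k i j : dom a p ->
  pd a k (nabla_lower g X a i j) p = pd a k (pd a i (lower g X a j)) p -
  (\sum_q pd a k (christoffel g a q i j) p * lower g X a q p
   + \sum_q christoffel g a q i j p * pd a k (lower g X a q) p).
Proof.
move=> ap; apply: pd_val; rewrite -big_split/=; apply: is_pdB.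
  exact: Ck_is_pd (Ck_pd i (lower_Ck 2 j)) ap.
apply: is_pd_sum => q; apply: is_pdM => //.
  exact: Ck_is_pd (christoffel_Ck 1 _ _ _) ap.
exact: Ck_is_pd (lower_Ck 1 _) ap.
Qed.

Lemma ricci_identity p k i j : dom a p ->
  nabla2_lower X k i j p - nabla2_lower X i k j p =
  - \sum_l riemann g a k i j l p * lower g X a l p.
Proof.
move=> ap; rewrite /nabla2_lower !pd_nabla_lower//.
rewrite (pd_comm oa aa k i (lower_Ck 2 j) ap).
exact: (@ricci_algebra _ _ (fun l r s => christoffel g a l r s p)
  (fun k l r s => pd a k (christoffel g a l r s) p) (fun l => lower g X a l p)
  (fun k l => pd a k (lower g X a l) p) _ k i j (fun l r s => christoffelC l r s ap)).
Qed.

Hypothesis kX : killing g X.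

Lemma nabla_lowerN p i j : dom a p ->
  nabla_lower g X a i j p = - nabla_lower g X a j i p.
Proof. by move=> ap; apply/eqP; rewrite -addr_eq0 kX. Qed.

(** The antisymmetry of nabla X holds on the whole chart domain, so it survives differentiation, and
    the Christoffel corrections respect it. *)
Lemma nabla2_lowerN p k i j : dom a p ->
  nabla2_lower X k i j p = - nabla2_lower X k j i p.
Proof.
move=> ap; rewrite /nabla2_lower.
have -> : pd a k (nabla_lower g X a i j) p = - pd a k (nabla_lower g X a j i) p.
  have D := is_pdN (Ck_is_pd k (nabla_lower_Ck 1 j i) ap).
  apply: pd_val; apply: (near_is_pd ap _ D).
  have := @open_nbhs_nbhs _ p _ (conj oa ap).
  by apply: filterS => q aq; rewrite [RHS]nabla_lowerN.
have -> : \sum_l christoffel g a l k i p * nabla_lower g X a l j p =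
    - \sum_l christoffel g a l k i p * nabla_lower g X a j l p.
  by rewrite -sumrN; apply: eq_bigr => l _; rewrite (nabla_lowerN _ _ ap) mulrN.
have -> : \sum_l christoffel g a l k j p * nabla_lower g X a i l p =
    - \sum_l christoffel g a l k j p * nabla_lower g X a l i p.
  by rewrite -sumrN; apply: eq_bigr => l _; rewrite (nabla_lowerN _ _ ap) mulrN.
ring.
Qed.

Variable K : R.
Hypothesis cK : constant_curvature g K.

(** Moving the metric from [X_r] onto the curvature turns the left-hand side into [X^k R_ijkl], to
    which the hypothesis on the curvature applies. *)
Lemma sum_riemann_lower p i j l : dom a p ->
  \sum_r riemann g a i j l r p * lower g X a r p =
  K * (lower g X a i p * g a p j l - lower g X a j p * g a p i l).
Proof.
move=> ap; transitivity (\sum_k X a p 0 k * curv g a i j k l p).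
  under [RHS]eq_bigr => k _ do rewrite /curv mulr_sumr.
  rewrite exchange_big/=; apply: eq_bigr => r _; rewrite /lower mulr_sumr.
  by apply: eq_bigr => k _; ring.
under eq_bigr => k _ do rewrite cK//.
rewrite /lower !mulr_suml -sumrB mulr_sumr; apply: eq_bigr => k _; ring.
Qed.

(** Kostant's formula for the second derivative of a Killing field, in its constant curvature
    form. *)
Lemma nabla2_killing p k i j : dom a p ->
  nabla2_lower X k i j p =
  K * (lower g X a i p * g a p k j - lower g X a j p * g a p k i).
Proof.
move=> ap.
apply: (@killing_algebra _ _ (fun k i j => nabla2_lower X k i j p) (g a p)
  (fun i => lower g X a i p)).
- by move=> r s; exact: metricC.
- by move=> *; exact: nabla2_lowerN.
- by move=> *; rewrite ricci_identity// sum_riemann_lower.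
Qed.

End KillingField.

Section ConstantCurvature.
Variable K : R.
Hypothesis cK : constant_curvature g K.

Lemma curv_up_const p i j k l : dom a p ->
  curv_up g a i j k l p =
  K * ((i == k)%:R * g a p j l - (i == l)%:R * g a p j k).
Proof.
move=> ap; rewrite /curv_up -!(sum_inv_metric _ _ ap) !mulr_suml -sumrB mulr_sumr.
by apply: eq_bigr => q _; rewrite cK//; ring.
Qed.

Lemma nabla_curv_const p r i j k l : dom a p -> nabla_curv g a r i j k l p = 0.
Proof.
move=> ap; rewrite /nabla_curv.
have dg s t := Ck_is_pd r (metric_Ck 1 s t) ap.
have -> : pd a r (curv g a i j k l) p = K *
   (pd a r (fun x => g a x i k) p * g a p j l
    + g a p i k * pd a r (fun x => g a x j l) p
    - (pd a r (fun x => g a x i l) p * g a p j k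
       + g a p i l * pd a r (fun x => g a x j k) p)).
  have D := is_pdZ K ap (is_pdB (is_pdM ap (dg i k) (dg j l))
    (is_pdM ap (dg i l) (dg j k))).
  apply: pd_val; apply: (near_is_pd ap _ D).
  have := @open_nbhs_nbhs _ p _ (conj oa ap).
  by apply: filterS => x ax; rewrite cK.
apply/eqP; rewrite subr_eq0; apply/eqP.
have := @nabla_curv_algebra _ _ (fun q s => christoffel g a q r s p) (g a p) K i j k l.
rewrite /= -!(metric_compat r _ _ ap) => ->.
by apply: eq_bigr => q _; rewrite !cK.
Qed.

Lemma nabla_curv_sharp_const p s i j k l : dom a p ->
  nabla_curv_sharp g a s i j k l p = 0.
Proof.
by move=> ap; rewrite /nabla_curv_sharp big1// => r _; rewrite nabla_curv_const// mulr0.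
Qed.

End ConstantCurvature.

End LeviCivitaIdentities.

(** * Orthonormal frames and their connection form *)

Section OrthonormalFrame.
Context {R : realType} {m : nat} {M : manifold R m} {h : metric M}.
Context {gam : clifford_rep R m} (sp : spin_structure h gam).
Variables (t : sp_idx sp) (a : chart M) (p : M).
Hypotheses (tp : sp_dom t p) (ap : dom a p).
Implicit Types (mu nu al be ga : 'I_m).

Lemma frame_is_pd mu be i :
  is_pd a mu (fun q => frame t be a q 0 i) p (pd a mu (fun q => frame t be a q 0 i) p).
Proof.
have := (frame_field t be).1 a i a 1%N; rewrite -setIA setIid => /Ck_is_pd; exact.
Qed.

(** The function h(e_be, e_ga) is constant on the open set where frame and chart both live; its
    vanishing derivative is the sum of the two connection coefficients. *)
Lemma spin_formN mu be ga : spin_form t a mu be ga p = - spin_form t a mu ga be p.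
Proof.
set e := fun al (q : M) i => frame t al a q 0 i.
set de := fun al i => pd a mu (fun q => e al q i) p.
set G := fun k j => christoffel h a k mu j p.
have dh i j := Ck_is_pd mu (metric_Ck h a 1 i j) ap.
have D0 : \sum_i \sum_j
    ((pd a mu (fun q => h a q i j) p * e be p i + h a p i j * de be i) * e ga p j
     + h a p i j * e be p i * de ga j) = 0.
  have := @is_pd_sum _ _ _ a mu p m
    (fun i q => \sum_j h a q i j * e be q i * e ga q j) _
    (fun i => is_pd_sum (fun j => is_pdM ap (is_pdM ap (dh i j) (frame_is_pd mu be i))
        (frame_is_pd mu ga j))).
  move=> /pd_val <-; apply: pd_val.
  apply: near_is_pd (is_pd_cst a mu p (be == ga)%:R) => //.
  have o : open (sp_dom t `&` dom a) by apply: openI; [exact: sp_open|exact: dom_open].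
  have := @open_nbhs_nbhs _ p _ (conj o (conj tp ap)).
  by apply: filterS => q [tq aq]; rewrite /cst -(frame_orthonormal tq aq).
apply/eqP; rewrite -addr_eq0; apply/eqP; rewrite -[RHS]D0 /spin_form /inner.
have := @frame_product_algebra _ _ (h a p) (fun i j => pd a mu (fun q => h a q i j) p)
  G (e be p) (e ga p) (de be) (de ga) (fun i j => metricC h i j ap)
  (fun i j => metric_compat h mu i j ap).
move=> <-; congr (_ + _); apply: eq_bigr => i _; apply: eq_bigr => j _.
  by rewrite mxE.
by rewrite mxE.
Qed.

(** Orthonormality reads E h E^T = 1. For square matrices a one-sided inverse is two-sided, and h
    E^T E = 1 is the completeness of the frame. *)
Lemma frame_expansion (v : 'rV[R]_m) nu :
  \sum_be inner h a p v (frame t be a p) * frame t be a p 0 nu = v 0 nu.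
Proof.
pose E : 'M[R]_m := \matrix_(be, i) frame t be a p 0 i.
have EhE : E *m (h a p *m E^T) = 1%:M.
  apply/matrixP => be ga; rewrite !mxE -(frame_orthonormal tp ap) /inner.
  apply: eq_bigr => i _; rewrite !mxE mulr_sumr; apply: eq_bigr => j _.
  by rewrite !mxE mulrCA mulrA.
have /(congr1 (fun A => (v *m A) 0 nu)) := mulmx1C EhE.
rewrite mulmx1 => <-; rewrite !mulmxA mxE; apply: eq_bigr => be _.
rewrite [X in _ = _ * X]mxE; congr (_ * _); rewrite mxE /inner exchange_big/=.
apply: eq_bigr => j _; rewrite !mxE mulr_suml; apply: eq_bigr => i _.
by rewrite [h a p i j * _]mulrC.
Qed.

End OrthonormalFrame.

(** * Hermitian products, Clifford multiplication and the spin connection *)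

Section HermitianProduct.
Context {R : realType} {d : nat}.
Implicit Types (u v w : 'cV[R[i]]_d) (c : R[i]) (r : R) (A : 'M[R[i]]_d).

Lemma hermDl u v w : herm (u + v) w = herm u w + herm v w.
Proof.
rewrite /herm -big_split; apply: eq_bigr => i _ /=.
by rewrite mxE rmorphD mulrDl.
Qed.

Lemma hermDr u v w : herm u (v + w) = herm u v + herm u w.
Proof. by rewrite /herm -big_split; apply: eq_bigr => i _; rewrite mxE mulrDr. Qed.

Lemma hermZl c u v : herm (c *: u) v = conjc c * herm u v.
Proof.
by rewrite /herm mulr_sumr; apply: eq_bigr => i _; rewrite mxE rmorphM mulrA.
Qed.

Lemma hermZr c u v : herm u (c *: v) = c * herm u v.
Proof. by rewrite /herm mulr_sumr; apply: eq_bigr => i _; rewrite mxE mulrCA. Qed.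

Lemma hermNr u v : herm u (- v) = - herm u v.
Proof. by rewrite -scaleN1r hermZr mulN1r. Qed.

Lemma herm0l v : herm 0 v = 0.
Proof. by rewrite -(scale0r (0 : 'cV_d)) hermZl rmorph0 mul0r. Qed.

Lemma herm0r u : herm u 0 = 0.
Proof. by rewrite -(scale0r (0 : 'cV_d)) hermZr mul0r. Qed.

Lemma herm_suml (I : finType) (F : I -> 'cV[R[i]]_d) v :
  herm (\sum_i F i) v = \sum_i herm (F i) v.
Proof.
elim: (index_enum I) => [|i s ih]; first by rewrite !big_nil herm0l.
by rewrite !big_cons hermDl ih.
Qed.

Lemma herm_sumr (I : finType) (F : I -> 'cV[R[i]]_d) u :
  herm u (\sum_i F i) = \sum_i herm u (F i).
Proof.
elim: (index_enum I) => [|i s ih]; first by rewrite !big_nil herm0r.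
by rewrite !big_cons hermDr ih.
Qed.

Lemma hermRl r u v : herm (r%:C *: u) v = r%:C * herm u v.
Proof. by rewrite hermZl conjc_real. Qed.

Lemma hermJ u v : conjc (herm u v) = herm v u.
Proof.
rewrite /herm rmorph_sum; apply: eq_bigr => i _.
by rewrite rmorphM /= conjcK mulrC.
Qed.

Lemma herm_mull A u v : herm (A *m u) v = herm u ((map_mx (@conjc R) A)^T *m v).
Proof.
rewrite /herm; under eq_bigr => i _ do rewrite mxE rmorph_sum mulr_suml.
rewrite exchange_big; apply: eq_bigr => j _ /=.
rewrite mxE mulr_sumr; apply: eq_bigr => i _.
by rewrite rmorphM !mxE [_ * conjc (u _ _)]mulrC mulrA.
Qed.

End HermitianProduct.

Section CliffordAlgebra.
Context {R : realType} {m : nat} (gam : clifford_rep R m).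
Implicit Types (u v : 'cV[R[i]]_(spdim m)) (al be ga : 'I_m).

Lemma herm_gam al u v : herm (gam al *m u) v = - herm u (gam al *m v).
Proof. by rewrite herm_mull gam_skew mulNmx hermNr. Qed.

Variable om : 'I_m -> 'I_m -> R.
Hypothesis omN : forall be ga, om be ga = - om ga be.

(** The element of the Lie algebra of Spin(m) that lies over the skew matrix [om]; with [om] the
    connection form it is the zeroth-order part of the spin connection. *)
Definition spin_matrix : 'M[R[i]]_(spdim m) :=
  4^-1 *: \sum_be \sum_ga (om be ga)%:C *: (gam be *m gam ga).

(** Compatibility of the spin connection with Clifford multiplication. The 1/4 offsets the 2 of the
    Clifford relation and the two equal contributions that antisymmetry of [om] produces. *)
Lemma spin_matrix_comm al :
  gam al *m spin_matrix - spin_matrix *m gam al =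
  - \sum_be (om al be)%:C *: gam be.
Proof.
rewrite /spin_matrix -scalemxAr -scalemxAl -scalerBr.
(* [gam al] is carried past one factor at a time; the two intermediate products cancel. *)
have E be ga : gam al *m (gam be *m gam ga) - gam be *m gam ga *m gam al =
    - 2 *: ((al == be)%:R *: gam ga - (al == ga)%:R *: gam be).
  transitivity ((gam al *m gam be + gam be *m gam al) *m gam ga -
      gam be *m (gam al *m gam ga + gam ga *m gam al)).
    rewrite mulmxDl mulmxDr !mulmxA opprD addrA addrK //.
  by rewrite !clifford mul_scalar_mx mul_mx_scalar scalerBr !scalerA //.
have -> : gam al *m (\sum_be \sum_ga (om be ga)%:C *: (gam be *m gam ga)) -
   (\sum_be \sum_ga (om be ga)%:C *: (gam be *m gam ga)) *m gam al =
   \sum_be \sum_ga (om be ga)%:C *: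
     (- 2 *: ((al == be)%:R *: gam ga - (al == ga)%:R *: gam be)).
  rewrite mulmx_sumr mulmx_suml -sumrB; apply: eq_bigr => be _.
  rewrite mulmx_sumr mulmx_suml -sumrB; apply: eq_bigr => ga _.
  by rewrite -scalemxAr -scalemxAl -scalerBr E.
have -> : \sum_be \sum_ga (om be ga)%:C *:
     (- 2 *: ((al == be)%:R *: gam ga - (al == ga)%:R *: gam be)) =
   - 2 *: (\sum_ga (om al ga)%:C *: gam ga - \sum_be (om be al)%:C *: gam be).
  transitivity (- 2 *: (\sum_be \sum_ga ((om be ga)%:C * (al == be)%:R) *: gam ga -
      \sum_be \sum_ga ((om be ga)%:C * (al == ga)%:R) *: gam be)).
    rewrite -sumrB scaler_sumr; apply: eq_bigr => be _.
    rewrite -sumrB scaler_sumr; apply: eq_bigr => ga _.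
    rewrite -!(scalerA (om be ga)%:C) -scalerBr !scalerA.
    by rewrite [(om be ga)%:C * _]mulrC.
  congr (_ *: (_ - _)).
    rewrite (bigD1 al)//= [X in _ + X]big1 ?addr0 => [|be bal].
      by apply: eq_bigr => ga _; rewrite eqxx mulr1.
    by rewrite big1// => ga _; rewrite eq_sym (negbTE bal) mulr0 scale0r.
  apply: eq_bigr => be _.
  rewrite (bigD1 al)//= [X in _ + X]big1 ?addr0 ?eqxx ?mulr1// => ga gal.
  by rewrite eq_sym (negbTE gal) mulr0 scale0r.
have -> : \sum_be (om be al)%:C *: gam be = - \sum_be (om al be)%:C *: gam be.
  by rewrite -sumrN; apply: eq_bigr => be _; rewrite omN rmorphN scaleNr.
rewrite opprK -mulr2n -[X in _ *: (_ *: X)]scaler_nat !scalerA.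
rewrite -[RHS]scaleN1r; congr (_ *: _).
by field.
Qed.

(** The adjoint of a product of two skew factors is the product in reverse order; renaming the
    summation indices then costs the sign of [om]. *)
Lemma herm_spin_matrix u v : herm (spin_matrix *m u) v = - herm u (spin_matrix *m v).
Proof.
rewrite /spin_matrix -!scalemxAl hermZl hermZr rmorphV ?unitfE// rmorph_nat.
rewrite -mulrN; congr (_ * _).
have E w : (\sum_be \sum_ga (om be ga)%:C *: (gam be *m gam ga)) *m w =
    \sum_be \sum_ga (om be ga)%:C *: (gam be *m (gam ga *m w)).
  rewrite mulmx_suml; apply: eq_bigr => be _; rewrite mulmx_suml.
  by apply: eq_bigr => ga _; rewrite -scalemxAl mulmxA.
rewrite !E herm_suml herm_sumr.
under eq_bigr => be _ do rewrite herm_suml.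
under [in RHS]eq_bigr => be _ do rewrite herm_sumr.
rewrite exchange_big/= -sumrN; apply: eq_bigr => be _; rewrite -sumrN.
apply: eq_bigr => ga _; rewrite hermRl hermZr !herm_gam opprK.
by rewrite omN rmorphN mulNr.
Qed.

(** In the derivative of <u, e_al v> the spin terms collapse to minus the term of nabla e_al, which
    is the one that a divergence subtracts. *)
Lemma spin_matrix_herm al u v :
  herm (spin_matrix *m u) (gam al *m v) + herm u (gam al *m (spin_matrix *m v)) =
  - \sum_be (om al be)%:C * herm u (gam be *m v).
Proof.
rewrite herm_spin_matrix addrC -hermNr -hermDr !mulmxA -mulmxBl spin_matrix_comm.
rewrite mulNmx hermNr mulmx_suml herm_sumr; congr (- _); apply: eq_bigr => be _.
by rewrite -scalemxAl hermZr.
Qed.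

End CliffordAlgebra.

(** * The index algebra of the divergence *)

Lemma sum_antisym (R : realFieldType) n (F : 'I_n -> 'I_n -> R) (v : 'I_n -> R) :
  (forall i j, F i j = - F j i) -> \sum_i \sum_j v i * v j * F i j = 0.
Proof.
move=> FN; set s := LHS; have : s = - s.
  rewrite {1}/s exchange_big/= /s -sumrN; apply: eq_bigr => i _.
  by rewrite -sumrN; apply: eq_bigr => j _; rewrite FN; ring.
by move=> sN; lra.
Qed.

(* The frame [f], the connection form [om] of its member [e], and the
   Christoffel symbols [GM], [GN] of the two metrics enter only through the
   structure equation; [P] and [L] stand for [d phi] and the covector [X]. *)
Lemma divergence_dphi_algebra (R : realFieldType) m n (e : 'I_m -> R)
    (f om de : 'I_m -> 'I_m -> R) (GM : 'I_m -> 'I_m -> 'I_m -> R)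
    (P : 'I_m -> 'I_n -> R) (dP : 'I_m -> 'I_m -> 'I_n -> R)
    (GN : 'I_n -> 'I_n -> 'I_n -> R) (L : 'I_n -> R) (dL : 'I_n -> 'I_n -> R) :
  (forall mu nu, \sum_be om mu be * f be nu = de mu nu + \sum_k GM nu mu k * e k) ->
  let S i j := dL i j - \sum_r GN r i j * L r in
  (forall i j, S i j = - S j i) ->
  let push (w : 'I_m -> R) i := \sum_nu w nu * P nu i in
  \sum_mu e mu *
    (2 * (\sum_i ((\sum_nu (de mu nu * P nu i + e nu * dP mu nu i)) * L i
                 + push e i * (\sum_k P mu k * dL k i)))
     - \sum_be om mu be * (2 * \sum_i push (f be) i * L i)) =
  2 * \sum_r (\sum_mu \sum_nu e mu * e nu *
    (dP mu nu r - \sum_la GM la mu nu * P la r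
     + \sum_j \sum_k GN r j k * P mu j * P nu k)) * L r.
Proof.
move=> omE S SN push.
have H1 mu i : \sum_be om mu be * push (f be) i =
    \sum_nu (de mu nu + \sum_k GM nu mu k * e k) * P nu i.
  under eq_bigr => be _ do rewrite mulr_sumr.
  rewrite exchange_big/=; apply: eq_bigr => nu _; rewrite -omE mulr_suml.
  by apply: eq_bigr => be _; rewrite mulrA.
have H2 mu : \sum_be om mu be * (2 * \sum_i push (f be) i * L i) =
    2 * \sum_i (\sum_be om mu be * push (f be) i) * L i.
  under eq_bigr => be _ do rewrite mulrCA mulr_sumr.
  rewrite -mulr_sumr exchange_big/=; congr (_ * _); apply: eq_bigr => i _.
  by rewrite mulr_suml; apply: eq_bigr => be _; rewrite mulrA.
(* The turning of the frame drops out here: by the structure equation the derivatives [de] cancel,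
   and the part of the Hessian that involves the metric of [M] remains. *)
have H3 mu i : \sum_nu (de mu nu * P nu i + e nu * dP mu nu i) -
      \sum_be om mu be * push (f be) i =
    \sum_nu e nu * (dP mu nu i - \sum_la GM la mu nu * P la i).
  rewrite H1.
  have -> : \sum_nu (de mu nu + \sum_k GM nu mu k * e k) * P nu i =
      \sum_nu de mu nu * P nu i + \sum_nu e nu * (\sum_la GM la mu nu * P la i).
    under eq_bigr => nu _ do rewrite mulrDl mulr_suml.
    rewrite big_split/=; congr (_ + _); rewrite exchange_big/=.
    apply: eq_bigr => nu _; rewrite mulr_sumr; apply: eq_bigr => la _; ring.
  rewrite big_split/= opprD addrACA subrr add0r -sumrB.
  by apply: eq_bigr => nu _; rewrite mulrBr.
pose A i := \sum_mu e mu * \sum_nu e nu * (dP mu nu i - \sum_la GM la mu nu * P la i).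
have LE : \sum_mu e mu *
    (2 * (\sum_i ((\sum_nu (de mu nu * P nu i + e nu * dP mu nu i)) * L i
                 + push e i * (\sum_k P mu k * dL k i)))
     - \sum_be om mu be * (2 * \sum_i push (f be) i * L i)) =
    2 * (\sum_i A i * L i + \sum_i \sum_k push e i * push e k * dL k i).
  transitivity (2 * \sum_mu \sum_i (e mu *
    (\sum_nu e nu * (dP mu nu i - \sum_la GM la mu nu * P la i)) * L i +
    e mu * (push e i * (\sum_k P mu k * dL k i)))).
    rewrite mulr_sumr; apply: eq_bigr => mu _; rewrite H2 -mulrBr mulrCA.
    congr (_ * _); rewrite -sumrB mulr_sumr; apply: eq_bigr => i _; rewrite -H3.
    ring.
  congr (_ * _); rewrite exchange_big/= -big_split; apply: eq_bigr => i _ /=.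
  rewrite big_split/=; congr (_ + _).
    by rewrite /A mulr_suml.
  under eq_bigr => mu _ do rewrite !mulr_sumr.
  rewrite exchange_big/=; apply: eq_bigr => k _.
  rewrite [push e k]/push mulr_sumr mulr_suml; apply: eq_bigr => mu _; ring.
have B r : \sum_mu e mu * \sum_nu e nu * (\sum_j \sum_k GN r j k * P mu j * P nu k) =
    \sum_j \sum_k GN r j k * push e j * push e k.
  transitivity (\sum_mu \sum_nu \sum_j \sum_k
      GN r j k * (e mu * P mu j) * (e nu * P nu k)).
    apply: eq_bigr => mu _; rewrite mulr_sumr; apply: eq_bigr => nu _.
    rewrite !mulr_sumr; apply: eq_bigr => j _; rewrite !mulr_sumr.
    by apply: eq_bigr => k _; ring.
  under eq_bigr => mu _ do rewrite exchange_big/=.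
  rewrite exchange_big/=; apply: eq_bigr => j _.
  under eq_bigr => mu _ do rewrite exchange_big/=.
  rewrite exchange_big/=; apply: eq_bigr => k _.
  rewrite -mulrA [push e j]/push mulr_suml mulr_sumr; apply: eq_bigr => mu _.
  rewrite /push !mulr_sumr; apply: eq_bigr => nu _; ring.
have RE r : \sum_mu \sum_nu e mu * e nu *
    (dP mu nu r - \sum_la GM la mu nu * P la r
     + \sum_j \sum_k GN r j k * P mu j * P nu k) =
    A r + \sum_j \sum_k GN r j k * push e j * push e k.
  rewrite -B /A -big_split; apply: eq_bigr => mu _ /=.
  rewrite -mulrDr -big_split mulr_sumr; apply: eq_bigr => nu _ /=; ring.
(* The two sides differ by [push e] taken twice and contracted with [dL] minus its Christoffel term,
   that is with the antisymmetric [S]. *)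
rewrite LE; congr (_ * _); under [in RHS]eq_bigr => r _ do rewrite RE mulrDl.
rewrite big_split/=; congr (_ + _); apply/eqP; rewrite -subr_eq0; apply/eqP.
apply: etrans _ (sum_antisym (push e) SN).
have -> : \sum_r (\sum_j \sum_k GN r j k * push e j * push e k) * L r =
    \sum_j \sum_k push e j * push e k * \sum_r GN r j k * L r.
  under eq_bigr => r _ do rewrite mulr_suml.
  rewrite exchange_big/=; apply: eq_bigr => j _.
  under eq_bigr => r _ do rewrite mulr_suml.
  rewrite exchange_big/=; apply: eq_bigr => k _; rewrite mulr_sumr.
  by apply: eq_bigr => r _; ring.
rewrite [X in X - _]exchange_big/= -sumrB; apply: eq_bigr => j _; rewrite -sumrB.
by apply: eq_bigr => k _; rewrite /S; ring.
Qed.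

(** The Christoffel terms of [N] are added and subtracted: one copy makes the derivative of the
    products [hh] covariant, the other makes [dS] the covariant derivative of [S]. Only renaming of
    indices is involved. *)
Lemma divergence_spinor_algebra (C : comPzRingType) n (d o hh : 'I_n -> 'I_n -> C)
    (P : 'I_n -> C) (S : 'I_n -> 'I_n -> C) (dS GN : 'I_n -> 'I_n -> 'I_n -> C) :
  \sum_i \sum_j (d i j * S i j + hh i j * \sum_k P k * dS k i j)
  - \sum_i \sum_j o i j * S i j =
  \sum_i \sum_j (d i j - o i j + \sum_q \sum_k GN i q k * P q * hh k j
                 + \sum_q \sum_k GN j q k * P q * hh i k) * S i j
  + \sum_i \sum_j hh i j * \sum_k P k * (dS k i j - \sum_l GN l k i * S l j
                                         - \sum_l GN l k j * S i l).
Proof.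
have E1 : \sum_i \sum_j (\sum_q \sum_k GN i q k * P q * hh k j) * S i j =
    \sum_i \sum_j hh i j * \sum_k P k * \sum_l GN l k i * S l j.
  transitivity (\sum_i \sum_j \sum_q \sum_k GN i q k * P q * hh k j * S i j).
    apply: eq_bigr => i _; apply: eq_bigr => j _; rewrite mulr_suml.
    by apply: eq_bigr => q _; rewrite mulr_suml.
  transitivity (\sum_i \sum_j \sum_k \sum_l GN l k i * P k * hh i j * S l j); last first.
    apply: eq_bigr => i _; apply: eq_bigr => j _; rewrite mulr_sumr.
    apply: eq_bigr => q _; rewrite !mulr_sumr; apply: eq_bigr => l _; ring.
  rewrite exchange_big/= [RHS]exchange_big/=; apply: eq_bigr => j _.
  rewrite exchange_big/= [RHS]exchange_big/=; apply: eq_bigr => q _.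
  exact: exchange_big.
have E2 : \sum_i \sum_j (\sum_q \sum_k GN j q k * P q * hh i k) * S i j =
    \sum_i \sum_j hh i j * \sum_k P k * \sum_l GN l k j * S i l.
  apply: eq_bigr => i _.
  transitivity (\sum_j \sum_q \sum_k GN j q k * P q * hh i k * S i j).
    apply: eq_bigr => j _; rewrite mulr_suml.
    by apply: eq_bigr => q _; rewrite mulr_suml.
  transitivity (\sum_j \sum_k \sum_l GN l k j * P k * hh i j * S i l); last first.
    apply: eq_bigr => j _; rewrite mulr_sumr.
    apply: eq_bigr => q _; rewrite !mulr_sumr; apply: eq_bigr => l _; ring.
  rewrite exchange_big/= [RHS]exchange_big/=; apply: eq_bigr => q _.
  exact: exchange_big.
have E3 : \sum_i \sum_j hh i j * \sum_k P k * (dS k i j - \sum_l GN l k i * S l j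
                                         - \sum_l GN l k j * S i l) =
    \sum_i \sum_j hh i j * (\sum_k P k * dS k i j)
    - \sum_i \sum_j hh i j * (\sum_k P k * \sum_l GN l k i * S l j)
    - \sum_i \sum_j hh i j * (\sum_k P k * \sum_l GN l k j * S i l).
  rewrite -!sumrB; apply: eq_bigr => i _; rewrite -!sumrB; apply: eq_bigr => j _.
  rewrite -!mulrBr -!sumrB; congr (_ * _); apply: eq_bigr => k _; ring.
rewrite E3 -E1 -E2 -!sumrB -!big_split; apply: eq_bigr => i _ /=.
rewrite -!sumrB -!big_split; apply: eq_bigr => j _ /=; ring.
Qed.

(** * The divergence of the current *)

Section Current.
Context {R : realType} {m n : nat} {M : manifold R m} {h : metric M}.
Context {gam : clifford_rep R m} (sp : spin_structure h gam).
Context {N : manifold R n} (g : metric N) (phi : M -> N).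
Variable psi : sp_idx sp -> chart N -> M -> 'I_n -> 'cV[R[i]]_(spdim m).
Variable X : chart N -> N -> 'rV[R]_n.
Hypotheses (vX : vector_field_on setT X) (kX : killing g X).
Hypotheses (sphi : smooth_map phi) (spsi : vector_spinor phi psi).
Variables (t : sp_idx sp) (a : chart M) (b : chart N) (p : M).
Hypotheses (tp : sp_dom t p) (ap : dom a p) (bp : dom b (phi p)).
Implicit Types (al be mu nu : 'I_m) (i j k l : 'I_n).

Let U : set M := phi @^-1` dom b `&` dom a.

Lemma coord_phi_Ck (s : nat) i : Ck a U s (fun q => coord b (phi q) 0 i).
Proof. exact: sphi.2 b i a s. Qed.

Lemma dphi_is_pd mu nu i :
  is_pd a mu (dphi phi a b nu i) p (pd a mu (dphi phi a b nu i) p).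
Proof. exact: (Ck_is_pd mu (Ck_pd nu (coord_phi_Ck 2 i)) (conj bp ap)). Qed.

Lemma comp_phi_is_pd mu (F : N -> R) : Ck b (dom b) 1 F ->
  is_pd a mu (fun q => F (phi q)) p (\sum_k dphi phi a b mu k p * pd b k F (phi p)).
Proof.
move=> CF; apply: (is_pd_comp ap _ _ _ bp CF) => //; first exact: sphi.1.
  exact: dom_open.
by move=> k; have [] := Ck_is_pd mu (coord_phi_Ck 1 k) (conj bp ap).
Qed.

Lemma dphi_frame_is_pd mu al i :
  is_pd a mu (fun q => dphi_frame phi t a b al i q) p
    (\sum_nu (pd a mu (fun q => frame t al a q 0 nu) p * dphi phi a b nu i p
              + frame t al a p 0 nu * pd a mu (dphi phi a b nu i) p)).
Proof.
apply: is_pd_sum => nu; apply: (is_pdM ap); first exact: frame_is_pd.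
exact: dphi_is_pd.
Qed.

Definition dpsi mu i : 'cV[R[i]]_(spdim m) :=
  \col_s pdC a mu (fun q => psi t b q i s 0) p.

Lemma psi_is_pdC mu i s :
  is_pdC a mu (fun q => psi t b q i s 0) p (dpsi mu i s 0).
Proof. by rewrite mxE; exact: (smoothC_is_pdC mu (spsi.1 t b i s)). Qed.

Lemma inner_lower al q :
  inner g b (phi q) (\row_i dphi_frame phi t a b al i q) (X b (phi q)) =
  \sum_i dphi_frame phi t a b al i q * lower g X b i (phi q).
Proof.
apply: eq_bigr => i _; rewrite /lower mulr_sumr; apply: eq_bigr => j _.
by rewrite mxE mulrCA mulrA.
Qed.

Lemma current_pdC mu al : pdC a mu (current g phi psi X t a b al) p =
  (2 * \sum_i
    ((\sum_nu (pd a mu (fun q => frame t al a q 0 nu) p * dphi phi a b nu i p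
              + frame t al a p 0 nu * pd a mu (dphi phi a b nu i) p))
     * lower g X b i (phi p)
     + dphi_frame phi t a b al i p
       * (\sum_k dphi phi a b mu k p * pd b k (lower g X b i) (phi p))))%:C
  - \sum_i \sum_j
     ((herm (dpsi mu i) (gam al *m psi t b p j)
       + herm (psi t b p i) (gam al *m dpsi mu j))
        * (nabla_lower g X b i j (phi p))%:C
      + herm (psi t b p i) (gam al *m psi t b p j)
        * (\sum_k dphi phi a b mu k p * pd b k (nabla_lower g X b i j) (phi p))%:C).
Proof.
apply: pdC_val; apply: is_pdCB => //.
  apply: is_pdC_real; apply: (is_pdZ _ ap).
  have -> : (fun q => inner g b (phi q) (\row_i dphi_frame phi t a b al i q)
      (X b (phi q))) = (fun q => \sum_i dphi_frame phi t a b al i q *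
      lower g X b i (phi q)) by apply/funext => q; exact: inner_lower.
  apply: is_pd_sum => i; apply: (is_pdM ap); first exact: dphi_frame_is_pd.
  by apply: comp_phi_is_pd; exact: lower_Ck.
apply: is_pdC_sum => i; apply: is_pdC_sum => j; apply: (is_pdCM ap).
  apply: (is_pdC_herm ap) => s; first exact: psi_is_pdC.
  by apply: (is_pdC_mulmx _ _ ap) => r; exact: psi_is_pdC.
apply: is_pdC_real; apply: comp_phi_is_pd; exact: nabla_lower_Ck.
Qed.

Lemma nabla_psiE mu i : nabla_psi g phi psi t a b mu i p =
  dpsi mu i + spin_matrix gam (fun be ga => spin_form t a mu be ga p) *m psi t b p i
  + \sum_j \sum_k (christoffel g b i j k (phi p) * dphi phi a b mu j p)%:C
                  *: psi t b p k.
Proof.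
congr (_ + _ + _); rewrite /spin_matrix -scalemxAl mulmx_suml; congr (_ *: _).
apply: eq_bigr => be _; rewrite mulmx_suml; apply: eq_bigr => ga _.
by rewrite -scalemxAl.
Qed.

(** The Leibniz rule with its corrections displayed: the rotation of e_al, which is all that the
    spin terms leave, and one Christoffel term of [N] for each of the free indices [i] and [j]. *)
Lemma herm_nabla_psi mu al i j :
  herm (nabla_psi g phi psi t a b mu i p) (gam al *m psi t b p j)
  + herm (psi t b p i) (gam al *m nabla_psi g phi psi t a b mu j p) =
  herm (dpsi mu i) (gam al *m psi t b p j)
  + herm (psi t b p i) (gam al *m dpsi mu j)
  - \sum_be (spin_form t a mu al be p)%:C
            * herm (psi t b p i) (gam be *m psi t b p j)
  + \sum_q \sum_k (christoffel g b i q k (phi p))%:C * (dphi phi a b mu q p)%:C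
       * herm (psi t b p k) (gam al *m psi t b p j)
  + \sum_q \sum_k (christoffel g b j q k (phi p))%:C * (dphi phi a b mu q p)%:C
       * herm (psi t b p i) (gam al *m psi t b p k).
Proof.
rewrite !nabla_psiE !mulmxDr !hermDl !hermDr.
rewrite -(spin_matrix_herm gam (fun be ga => spin_formN tp ap mu be ga)).
have -> : herm (\sum_q \sum_k
     (christoffel g b i q k (phi p) * dphi phi a b mu q p)%:C *: psi t b p k)
     (gam al *m psi t b p j) =
   \sum_q \sum_k (christoffel g b i q k (phi p))%:C * (dphi phi a b mu q p)%:C
       * herm (psi t b p k) (gam al *m psi t b p j).
  rewrite herm_suml; apply: eq_bigr => q _; rewrite herm_suml.
  by apply: eq_bigr => k _; rewrite hermRl rmorphM.
have -> : herm (psi t b p i) (gam al *m \sum_q \sum_k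
     (christoffel g b j q k (phi p) * dphi phi a b mu q p)%:C *: psi t b p k) =
   \sum_q \sum_k (christoffel g b j q k (phi p))%:C * (dphi phi a b mu q p)%:C
       * herm (psi t b p i) (gam al *m psi t b p k).
  rewrite mulmx_sumr herm_sumr; apply: eq_bigr => q _.
  rewrite mulmx_sumr herm_sumr; apply: eq_bigr => k _.
  by rewrite -scalemxAr hermZr rmorphM.
move: (herm (dpsi _ _) _) (herm _ (_ *m dpsi _ _)) => x1 x2.
move: (herm (_ *m psi t b p i) _) (herm _ (_ *m (_ *m psi t b p j))) => x3 x4.
move: (\sum_q _) (\sum_q _) => x5 x6.
ring.
Qed.

(** Skewness of Clifford multiplication moves [gam al] onto the derivative in the first slot, which
    is where the minus sign comes from. *)
Lemma herm_dirac i j :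
  \sum_al \sum_mu (frame t al a p 0 mu)%:C *
    (herm (nabla_psi g phi psi t a b mu i p) (gam al *m psi t b p j)
     + herm (psi t b p i) (gam al *m nabla_psi g phi psi t a b mu j p)) =
  herm (psi t b p i) (dirac g phi psi t a b j p)
  - herm (dirac g phi psi t a b i p) (psi t b p j).
Proof.
rewrite /dirac herm_sumr herm_suml -sumrB; apply: eq_bigr => al _.
rewrite herm_gam opprK herm_suml mulmx_sumr herm_sumr addrC -big_split/=.
apply: eq_bigr => mu _.
by rewrite hermRl -scalemxAr hermZr mulrDr.
Qed.

Lemma spin_form_frame mu al nu :
  \sum_be spin_form t a mu al be p * frame t be a p 0 nu =
  pd a mu (fun q => frame t al a q 0 nu) p
  + \sum_k christoffel h a nu mu k p * frame t al a p 0 k.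
Proof. by rewrite (frame_expansion tp ap) mxE. Qed.

Lemma real_part_split (e A O : R) (B D : R[i]) :
  e%:C * (A%:C - B - (O%:C - D)) = (e * (A - O))%:C - e%:C * (B - D).
Proof. rewrite rmorphM rmorphB; ring. Qed.

(** An identity for arbitrary smooth [phi] and [psi] along a Killing field; the field equations are
    inserted afterwards. *)
Lemma divergence_current :
  divergence t a (current g phi psi X t a b) p =
  (2 * \sum_r tension g phi t a b r p * lower g X b r (phi p))%:C
  - (\sum_i \sum_j (herm (psi t b p i) (dirac g phi psi t a b j p)
       - herm (dirac g phi psi t a b i p) (psi t b p j))
       * (nabla_lower g X b i j (phi p))%:C
     + \sum_al \sum_i \sum_j herm (psi t b p i) (gam al *m psi t b p j)
       * (\sum_k dphi_frame phi t a b al k p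
            * nabla2_lower g b X k i j (phi p))%:C).
Proof.
pose A mu al := 2 * \sum_i
    ((\sum_nu (pd a mu (fun q => frame t al a q 0 nu) p * dphi phi a b nu i p
              + frame t al a p 0 nu * pd a mu (dphi phi a b nu i) p))
     * lower g X b i (phi p)
     + dphi_frame phi t a b al i p
       * (\sum_k dphi phi a b mu k p * pd b k (lower g X b i) (phi p))).
pose B mu al := \sum_i \sum_j
     ((herm (dpsi mu i) (gam al *m psi t b p j)
       + herm (psi t b p i) (gam al *m dpsi mu j))
        * (nabla_lower g X b i j (phi p))%:C
      + herm (psi t b p i) (gam al *m psi t b p j)
        * (\sum_k dphi phi a b mu k p * pd b k (nabla_lower g X b i j) (phi p))%:C).
pose Jr be := 2 * \sum_i dphi_frame phi t a b be i p * lower g X b i (phi p).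
pose Js be := \sum_i \sum_j herm (psi t b p i) (gam be *m psi t b p j)
                  * (nabla_lower g X b i j (phi p))%:C.
pose om mu al be := spin_form t a mu al be p.
pose e al mu := frame t al a p 0 mu.
(* The contribution of [dphi] is kept inside [%:C], because its algebra is carried out over the
   reals; the spinor contribution stays complex. *)
have -> : divergence t a (current g phi psi X t a b) p =
    (\sum_al \sum_mu e al mu * (A mu al - \sum_be om mu al be * Jr be))%:C
    - \sum_al \sum_mu (e al mu)%:C * (B mu al - \sum_be (om mu al be)%:C * Js be).
  rewrite rmorph_sum -sumrB; apply: eq_bigr => al _.
  rewrite rmorph_sum -sumrB; apply: eq_bigr => mu _.
  rewrite -real_part_split current_pdC; congr (_ * (_ - _)).
  rewrite rmorph_sum -sumrB; apply: eq_bigr => be _.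
  by rewrite rmorphM -mulrBr /current inner_lower.
congr (_%:C - _).
  under [in RHS]eq_bigr => r _ do rewrite /tension mulr_suml.
  rewrite [in RHS]exchange_big/= mulr_sumr; apply: eq_bigr => al _.
  exact: (@divergence_dphi_algebra _ _ _ (e al) e (fun mu => om mu al)
    (fun mu nu => pd a mu (fun q => frame t al a q 0 nu) p)
    (fun la mu nu => christoffel h a la mu nu p) (fun mu i => dphi phi a b mu i p)
    (fun mu nu i => pd a mu (dphi phi a b nu i) p)
    (fun r i j => christoffel g b r i j (phi p)) (fun i => lower g X b i (phi p))
    (fun k i => pd b k (lower g X b i) (phi p))
    (fun mu nu => spin_form_frame mu al nu)
    (fun i j => nabla_lowerN kX i j bp)).
have Q al mu : B mu al - \sum_be (om mu al be)%:C * Js be =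
    \sum_i \sum_j
      (herm (nabla_psi g phi psi t a b mu i p) (gam al *m psi t b p j)
       + herm (psi t b p i) (gam al *m nabla_psi g phi psi t a b mu j p))
      * (nabla_lower g X b i j (phi p))%:C
    + \sum_i \sum_j herm (psi t b p i) (gam al *m psi t b p j)
       * (\sum_k dphi phi a b mu k p * nabla2_lower g b X k i j (phi p))%:C.
  have -> : \sum_be (om mu al be)%:C * Js be = \sum_i \sum_j
     (\sum_be (om mu al be)%:C * herm (psi t b p i) (gam be *m psi t b p j))
     * (nabla_lower g X b i j (phi p))%:C.
    under eq_bigr => be _ do rewrite mulr_sumr.
    rewrite exchange_big/=; apply: eq_bigr => i _.
    under eq_bigr => be _ do rewrite mulr_sumr.
    rewrite exchange_big/=; apply: eq_bigr => j _.
    by rewrite mulr_suml; apply: eq_bigr => be _; rewrite mulrA.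
  have realM (F G : 'I_n -> R) : (\sum_k F k * G k)%:C = \sum_k (F k)%:C * (G k)%:C.
    by rewrite rmorph_sum; apply: eq_bigr => k _; rewrite rmorphM.
  rewrite /B; under eq_bigr => i _ do under eq_bigr => j _ do rewrite realM.
  rewrite (divergence_spinor_algebra _ _ _ _ _ _
    (fun i q k => (christoffel g b i q k (phi p))%:C)).
  congr (_ + _).
    apply: eq_bigr => i _; apply: eq_bigr => j _; congr (_ * _).
    by rewrite herm_nabla_psi.
  apply: eq_bigr => i _; apply: eq_bigr => j _; congr (_ * _).
  rewrite realM; apply: eq_bigr => k _; congr (_ * _).
  by rewrite -!realM -!rmorphB.
transitivity (\sum_al \sum_mu (e al mu)%:C * (\sum_i \sum_j
      (herm (nabla_psi g phi psi t a b mu i p) (gam al *m psi t b p j)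
       + herm (psi t b p i) (gam al *m nabla_psi g phi psi t a b mu j p))
      * (nabla_lower g X b i j (phi p))%:C) +
   \sum_al \sum_mu (e al mu)%:C * (\sum_i \sum_j
      herm (psi t b p i) (gam al *m psi t b p j)
       * (\sum_k dphi phi a b mu k p * nabla2_lower g b X k i j (phi p))%:C)).
  rewrite -big_split; apply: eq_bigr => al _; rewrite -big_split.
  by apply: eq_bigr => mu _; rewrite Q mulrDr.
congr (_ + _).
  under eq_bigr => al _ do under eq_bigr => mu _ do rewrite mulr_sumr.
  under eq_bigr => al _ do rewrite exchange_big/=.
  rewrite exchange_big/=; apply: eq_bigr => i _.
  under eq_bigr => al _ do under eq_bigr => mu _ do rewrite mulr_sumr.
  under eq_bigr => al _ do rewrite exchange_big/=.
  rewrite exchange_big/=; apply: eq_bigr => j _.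
  rewrite -herm_dirac mulr_suml; apply: eq_bigr => al _; rewrite mulr_suml.
  by apply: eq_bigr => mu _; rewrite mulrA.
apply: eq_bigr => al _.
under eq_bigr => mu _ do rewrite mulr_sumr.
rewrite exchange_big/=; apply: eq_bigr => i _.
under eq_bigr => mu _ do rewrite mulr_sumr.
rewrite exchange_big/=; apply: eq_bigr => j _.
transitivity (herm (psi t b p i) (gam al *m psi t b p j) *
   (\sum_mu e al mu * \sum_k dphi phi a b mu k p * nabla2_lower g b X k i j (phi p))%:C).
  rewrite rmorph_sum mulr_sumr; apply: eq_bigr => mu _.
  by rewrite rmorphM mulrCA.
congr (_ * _%:C); under [LHS]eq_bigr => mu _ do rewrite mulr_sumr.
rewrite exchange_big/=; apply: eq_bigr => k _; rewrite /dphi_frame mulr_suml.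
by apply: eq_bigr => mu _; rewrite mulrA.
Qed.

End Current.

(** Contracting the deltas brings both sides to the entry i, j of tr(gH) H - H g H. *)
Lemma dirac_algebra (C : comPzRingType) n (H g : 'I_n -> 'I_n -> C) i j :
  (forall r s, g r s = g s r) ->
  \sum_q \sum_k \sum_l ((j == k)%:R * g q l - (j == l)%:R * g q k) * H q l * H i k =
  \sum_q \sum_k \sum_l ((i == k)%:R * g q l - (i == l)%:R * g q k) * H l q * H k j.
Proof.
move=> gC.
have reduce r (F G : 'I_n -> 'I_n -> 'I_n -> C) :
    (forall q k l, F q k l = (r == k)%:R * G q k l) ->
    \sum_q \sum_k \sum_l F q k l = \sum_q \sum_l G q r l.
  move=> FG; apply: eq_bigr => q _; rewrite exchange_big/=; apply: eq_bigr => l _.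
  by rewrite -(sum_delta_l (fun k => G q k l) r); apply: eq_bigr => k _.
have reduce' r (F G : 'I_n -> 'I_n -> 'I_n -> C) :
    (forall q k l, F q k l = (r == l)%:R * G q k l) ->
    \sum_q \sum_k \sum_l F q k l = \sum_q \sum_k G q k r.
  move=> FG; apply: eq_bigr => q _; apply: eq_bigr => k _.
  by rewrite -(sum_delta_l (fun l => G q k l) r); apply: eq_bigr => l _.
transitivity (\sum_q \sum_l g q l * H q l * H i j - \sum_q \sum_k g q k * H q j * H i k).
  transitivity (\sum_q \sum_k \sum_l (j == k)%:R * (g q l * H q l * H i k)
      - \sum_q \sum_k \sum_l (j == l)%:R * (g q k * H q l * H i k)).
    rewrite -sumrB; apply: eq_bigr => q _; rewrite -sumrB; apply: eq_bigr => k _.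
    by rewrite -sumrB; apply: eq_bigr => l _; ring.
  congr (_ - _).
    exact: (reduce j _ (fun q k l => g q l * H q l * H i k)).
  exact: (reduce' j _ (fun q k l => g q k * H q l * H i k)).
transitivity (\sum_q \sum_l g q l * H l q * H i j - \sum_q \sum_k g q k * H i q * H k j).
  congr (_ - _); rewrite exchange_big/=; apply: eq_bigr => q _; apply: eq_bigr => k _.
    by rewrite gC.
  by rewrite gC; ring.
transitivity (\sum_q \sum_k \sum_l (i == k)%:R * (g q l * H l q * H k j)
    - \sum_q \sum_k \sum_l (i == l)%:R * (g q k * H l q * H k j)).
  congr (_ - _); apply/esym.
    exact: (reduce i _ (fun q k l => g q l * H l q * H k j)).
  exact: (reduce' i _ (fun q k l => g q k * H l q * H k j)).
rewrite -sumrB; apply: eq_bigr => q _; rewrite -sumrB; apply: eq_bigr => k _.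
by rewrite -sumrB; apply: eq_bigr => l _; ring.
Qed.

Lemma conjc_realM (R : realType) (r : R) (z : R[i]) :
  conjc (r%:C * z) = r%:C * conjc z.
Proof. by rewrite rmorphM; congr (_ * _); exact: conjc_real. Qed.

(** * The field equations in constant curvature *)

Section ConstantCurvatureTarget.
Context {R : realType} {m n : nat} {M : manifold R m} {h : metric M}.
Context {gam : clifford_rep R m} (sp : spin_structure h gam).
Context {N : manifold R n} (g : metric N) (phi : M -> N).
Variable psi : sp_idx sp -> chart N -> M -> 'I_n -> 'cV[R[i]]_(spdim m).
Variables (X : chart N -> N -> 'rV[R]_n) (K kappa : R).
Hypotheses (cK : constant_curvature g K).
Hypotheses (vX : vector_field_on setT X) (kX : killing g X).
Hypothesis dh : kappa_dirac_harmonic g phi psi kappa.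
Variables (t : sp_idx sp) (a : chart M) (b : chart N) (p : M).
Hypotheses (tp : sp_dom t p) (ap : dom a p) (bp : dom b (phi p)).
Implicit Types (i j k l : 'I_n).

Lemma dirac_herm_sym i j :
  herm (psi t b p i) (dirac g phi psi t a b j p) =
  herm (dirac g phi psi t a b i p) (psi t b p j).
Proof.
rewrite (dh tp ap bp j).2 (dh tp ap bp i).2 hermZr hermRl; congr (_ * _).
pose H r s := herm (psi t b p r) (psi t b p s).
pose gC r s : R[i] := (g b (phi p) r s)%:C.
have curvC r q k l : (curv_up g b r q k l (phi p))%:C =
    K%:C * ((r == k)%:R * gC q l - (r == l)%:R * gC q k).
  by rewrite (curv_up_const cK)// rmorphM rmorphB !rmorphM !rmorph_nat.
transitivity (K%:C * \sum_q \sum_k \sum_l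
    ((j == k)%:R * gC q l - (j == l)%:R * gC q k) * H q l * H i k).
  rewrite herm_sumr mulr_sumr; apply: eq_bigr => q _.
  rewrite herm_sumr mulr_sumr; apply: eq_bigr => k _.
  rewrite herm_sumr mulr_sumr; apply: eq_bigr => l _.
  by rewrite hermZr curvC !mulrA.
(* The right-hand side produced here has [H l q] in place of [H q l]: this is the conjugate that the
   coefficients acquire in the first slot. *)
rewrite (dirac_algebra H i j (fun r s => congr1 _ (metricC g r s bp))).
rewrite herm_suml mulr_sumr; apply: eq_bigr => q _.
rewrite herm_suml mulr_sumr; apply: eq_bigr => k _.
rewrite herm_suml mulr_sumr; apply: eq_bigr => l _.
by rewrite hermZl conjc_realM hermJ curvC !mulrA.
Qed.

Lemma tension_killing :
  (2 * \sum_r tension g phi t a b r p * lower g X b r (phi p))%:C =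
  \sum_al \sum_i \sum_j herm (psi t b p i) (gam al *m psi t b p j)
    * (\sum_k dphi_frame phi t a b al k p * nabla2_lower g b X k i j (phi p))%:C.
Proof.
pose hh al i j := herm (psi t b p i) (gam al *m psi t b p j).
have tE r : (tension g phi t a b r p)%:C = 2^-1 * \sum_al \sum_i \sum_j \sum_l
    hh al i j * (riemann g b i j l r (phi p) * dphi_frame phi t a b al l p)%:C.
  (* The curvature is parallel, so the kappa term of the tension equation vanishes. *)
  rewrite (dh tp ap bp r).1 [X in _ + _ * X]big1 ?mulr0 ?addr0// => i _.
  rewrite big1// => j _; rewrite big1// => k _; rewrite big1// => l _.
  by rewrite (nabla_curv_sharp_const cK)// !mul0r.
transitivity (\sum_r (\sum_al \sum_i \sum_j \sum_l
    hh al i j * (riemann g b i j l r (phi p) * dphi_frame phi t a b al l p)%:C)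
    * (lower g X b r (phi p))%:C).
  rewrite rmorphM rmorph_nat rmorph_sum mulr_sumr; apply: eq_bigr => r _.
  by rewrite rmorphM [X in _ * (X * _)]tE !mulrA mulfV ?mul1r.
under eq_bigr => r _ do rewrite mulr_suml.
rewrite exchange_big/=; apply: eq_bigr => al _.
under eq_bigr => r _ do rewrite mulr_suml.
rewrite exchange_big/=; apply: eq_bigr => i _.
under eq_bigr => r _ do rewrite mulr_suml.
rewrite exchange_big/=; apply: eq_bigr => j _.
under eq_bigr => r _ do rewrite mulr_suml.
rewrite exchange_big/= rmorph_sum mulr_sumr; apply: eq_bigr => l _.
(* Reading [sum_riemann_lower] backwards turns Kostant's formula into <R(d_i, d_j) d_l, X>, the
   contraction already present on the left. *)
rewrite (nabla2_killing vX kX cK)// (metricC g l j bp) (metricC g l i bp).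
rewrite -(sum_riemann_lower X cK)// mulr_sumr rmorph_sum mulr_sumr.
by apply: eq_bigr => r _; rewrite -mulrA -rmorphM; congr (_ * _%:C); ring.
Qed.

End ConstantCurvatureTarget.

Theorem theorem4p7 (R : realType) (m n : nat)
  (M : manifold R m) (h : metric M)
  (gam : clifford_rep R m) (sp : spin_structure h gam)
  (N : manifold R n) (g : metric N) (K : R)
  (X : chart N -> N -> 'rV[R]_n) (kappa : R)
  (phi : M -> N)
  (psi : sp_idx sp -> chart N -> M -> 'I_n -> 'cV[R[i]]_(spdim m)) :
  closed_manifold M ->
  constant_curvature g K ->
  vector_field_on setT X -> killing g X ->
  smooth_map phi -> vector_spinor phi psi ->
  kappa_dirac_harmonic g phi psi kappa ->
  conserved phi (current g phi psi X).
Proof.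
move=> _ cK vX kX sphi spsi dh t a b p tp ap bp.
rewrite (divergence_current vX kX sphi spsi tp ap bp).
rewrite (tension_killing cK vX kX dh tp ap bp).
rewrite [X in _ - (X + _)]big1 ?add0r ?subrr// => i _.
by rewrite big1// => j _; rewrite (dirac_herm_sym cK dh tp ap bp) subrr mul0r.
Qed.
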